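(* Let $K\subset\mathbb{C}$ be a compact set with $\operatorname{cap}(K)>0$ and let $w$ be a Szegő class weight on $K$. Then for all $n\in\mathbb{N}$, $$\mathcal{W}_n(K,w) \geq S(w).\qquad ( * )$$ For a given $n\in\mathbb{N}$, equality in $( * )$ is attained if and only if there exists a monic polynomial $P_n$ of degree $n$ with all zeros on the set $\{z\in\mathbb{C}:g_K(z)=0\}$ and such that $w|P_n|=\|P_n\|_{K,w}$ $\rho_K$-almost everywhere, in which case $P_n=T_{n,w}^{(K)}$. If $K\subset\mathbb{R}$, or more generally if the polynomial convex hull $\hat K$ of $K$ has empty interior, then the inequality $( * )$ is strict for all $n\in\mathbb{N}$. Nevertheless, if $K\subset\mathbb{R}$, then for each $n\in\mathbb{N}$ the lower bound $( * )$ is sharp in the class of polynomial weights on $K$, that is, $$\inf_{w}\frac{\mathcal{W}_n(K,w)}{S(w)} = 1,$$ where the infimum is taken over all polynomials $w(z)$ that are positive on $K$.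
   Context: $\mathbb{N}=\{1,2,\dots\}$. $\|P\|_{K,w}=\sup_{z\in K}w(z)|P(z)|$. The weighted Chebyshev polynomial $T_{n,w}^{(K)}$ is the (unique) monic polynomial of degree $n$ minimizing $\|\cdot\|_{K,w}$ among all monic polynomials of degree $n$ with complex coefficients, and $t_n(K,w)=\|T_{n,w}^{(K)}\|_{K,w}$. $\operatorname{cap}(K)$ is the logarithmic capacity of $K$, and the Widom factor is $\mathcal{W}_n(K,w)=t_n(K,w)/\operatorname{cap}(K)^n$. $\Omega$ is the outer domain of $K$, i.e. the unbounded component of $\overline{\mathbb{C}}\setminus K$, and $\hat K=\mathbb{C}\setminus\Omega$ is the polynomial convex hull of $K$. $\rho_K$ is the equilibrium measure of $K$ (a probability measure supported on $\partial\Omega\subset K$), and the Green function of $\Omega$ with pole at $\infty$, extended to all of $\mathbb{C}$, is defined by $$g_K(z)=-\log\operatorname{cap}(K)+\int\log|z-\zeta|\,d\rho_K(\zeta),\qquad z\in\mathbb{C}.$$ A Szegő class weight on $K$ is a bounded Borel measurable function $w:K\to[0,\infty)$ with $\log w\in L^1(d\rho_K)$. The exponential Szegő integral is $$S(w)=\exp\left[\int\log w(\zeta)\,d\rho_K(\zeta)\right].$$ *)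

(* Defs.v *)
(* MathComp-Analysis, over an arbitrary R : realType; the plane is R[i]. *)
From HB Require Import structures.
From mathcomp Require Import all_boot all_order all_algebra.
From mathcomp Require Import all_classical all_reals all_analysis.
From mathcomp Require Import complex.

Set Implicit Arguments.
Unset Strict Implicit.
Unset Printing Implicit Defensive.

Import Order.TTheory GRing.Theory Num.Theory numFieldNormedType.Exports.

Local Open Scope classical_set_scope.
Local Open Scope ring_scope.

(* The norm topology and its Borel sigma-algebra; neither is attached to R[i]
   by the libraries. *)
HB.instance Definition _ (R : realType) := NormedModule.copy R[i] R[i]^o.

HB.instance Definition _ (R : realType) :=
  Measurable.copy R[i] (g_sigma_algebraType (@open R[i])).

(* The modulus as an element of R (the norm `|z| lives in R[i]). *)
Notation cmod z := (ComplexField.Normc.normc z).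

Section Potential.
Variable R : realType.
Local Notation C := R[i].
Implicit Types (K : set C) (mu rho : probability C R) (w : C -> R)
  (P : {poly C}) (n : nat).

(* The extended logarithm lne is used throughout, since ln 0 = 0 whereas
   lne 0 = -oo. *)

(* I(mu) = \int\int log (1 / |z - zeta|) dmu(zeta) dmu(z). *)
Definition energy mu : \bar R :=
  (\int[mu]_z \int[mu]_zeta (- lne (cmod (z - zeta))%:E))%E.

(* cap(K) = exp (- inf I(mu)), the infimum being over the probability measures
   carried by K; it is 0 when every such measure has infinite energy. *)
Definition cap K : R :=
  fine (expeR (- ereal_inf [set energy mu | mu in
                              [set mu : probability C R | mu K = 1%E]])%E).

Definition is_equilibrium_measure K rho : Prop :=
  rho K = 1%E /\
  forall mu : probability C R, mu K = 1%E -> (energy rho <= energy mu)%E.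

Definition green K rho (z : C) : \bar R :=
  ((- ln (cap K))%:E + \int[rho]_zeta lne (cmod (z - zeta))%:E)%E.

(* A weight is a function on K: it is given here as a function on the plane
   of which only the values on K are ever used. *)
Definition szego_class K rho w : Prop :=
  [/\ forall z, K z -> 0 <= w z,
      exists M : R, forall z, K z -> w z <= M,
      measurable_fun K w &
      rho.-integrable K (fun z => lne (w z)%:E)].

Definition szego_integral K rho w : R :=
  fine (expeR (\int[rho]_(z in K) lne (w z)%:E)%E).

Definition wnorm K w P : R := sup [set w z * cmod P.[z] | z in K].

Definition monic_of_degree n P : Prop := P \is monic /\ size P = n.+1.

Definition is_weighted_chebyshev K w n P : Prop :=
  monic_of_degree n P /\
  forall Q : {poly C}, monic_of_degree n Q -> wnorm K w P <= wnorm K w Q.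

(* T_{n,w}^{(K)}: the minimizer, selected by choice (0 if there were none). *)
Definition weighted_chebyshev K w n : {poly C} :=
  xget 0 [set P : {poly C} | is_weighted_chebyshev K w n P].

Definition widom_factor K w n : R :=
  wnorm K w (weighted_chebyshev K w n) / cap K ^+ n.

(* The unbounded component of the complement of K in the Riemann sphere, i.e.
   the component of the point at infinity (None). *)
Definition outer_domain K : set (one_point_compactification C) :=
  connected_component
    (~` ((Some : C -> one_point_compactification C) @` K)) None.

Definition polynomial_hull K : set C := [set z | ~ outer_domain K (Some z)].

Definition positive_poly_on K : set {poly C} :=
  [set p : {poly C} | forall z, K z -> 0 < p.[z]].

(* For p in positive_poly_on K, the values of p on K are real and positive
   (0 < u in R[i] entails Im u = 0), so p.[z] = (poly_weight p z)%:C there. *)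
Definition poly_weight (p : {poly C}) : C -> R := fun z => complex.Re p.[z].

End Potential.

(* Main.v *)
(* Jensen: for a monic polynomial P of degree n with zeros z_j,
     ln ||wP|| - ln (S(w) cap(K)^n)
       = int ln (||wP|| / (w |P|)) drho + sum_j g_K(z_j),
   and both terms are nonnegative as soon as g_K >= 0 on the whole plane; this
   gives the bound and its equality case.

   That g_K >= 0 everywhere is Frostman's theorem. Varying the minimizer gives
   g_K = 0 rho-a.e., hence g_K >= 0 on a set F of full measure, which is closed
   by semicontinuity. Near F the potential is controlled by its value at an
   almost nearest point of F, because rho (B(x, s)) = O(1 / ln (1/s)) uniformly
   for x in F; away from F one propagates a near-minimum of g_K towards F by a
   mean value inequality. Averages over circles are replaced by averages over
   the n-th roots of u^n, where
     sum_r ln |z + r - v| = ln |(v - z)^n - u^n|.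

   If equality held, P would have a zero z0 with g_K(z0) = 0 at positive
   distance from the support of rho (w is bounded), and the minimum principle
   would make g_K vanish on a disc. This is impossible if K is real (g_K is
   strictly monotone along vertical half-lines) or if the polynomial hull has
   empty interior (g_K > 0 on the outer domain).

   For K real, take P = (X - x0)^n with g_K(x0) = 0, x0 in K, and for w the n-th
   powers of the polynomials approximating 1 / |x - x0| from below that are given
   by Newton's iteration for s^(-1/2). *)
Require Import Defs.
Set Warnings "-all".
From mathcomp Require Import all_boot all_order all_algebra.
From mathcomp Require Import all_classical all_reals all_analysis.
From mathcomp Require Import complex.
From mathcomp Require Import lra ring measurable_realfun qpoly.

Import Order.TTheory GRing.Theory Num.Theory numFieldNormedType.Exports.

Local Open Scope classical_set_scope.
Local Open Scope ring_scope.

(** * Estimates for logarithms, Newton's iteration and two numerical inequalities used later *)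

Section RealEstimates.
Set Implicit Arguments.
Unset Strict Implicit.
Context {R : realType}.

Lemma ln_prod_seq (I : eqType) (rs : seq I) (F : I -> R) : (forall r, r \in rs -> 0 < F r) ->
  ln (\prod_(r <- rs) F r) = \sum_(r <- rs) ln (F r).
Proof.
elim: rs => [|r rs IH] rF; first by rewrite !big_nil ln1.
have rsF s : s \in rs -> 0 < F s by move=> srs; apply: rF; rewrite inE srs orbT.
rewrite !big_cons lnM ?IH// posrE; first by apply: rF; rewrite inE eqxx.
by rewrite big_seq prodr_gt0.
Qed.

(** As [x >= s - t], the increment [ln (1 + t / x)] is at most [t / (s - t)]: a displacement by [t]
    changes the logarithm of a distance of size at least [s] by a uniformly small amount. *)
Lemma log_le_add (x y t s : R) : 0 < x -> 0 < y -> 0 <= t -> t < s -> s <= y ->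
  y <= x + t -> ln y <= ln x + t / (s - t).
Proof.
move=> x0 y0 t0 ts sy yx.
have st : 0 < s - t by rewrite subr_gt0.
have sx : s - t <= x by lra.
have tx : 0 <= t / x by rewrite divr_ge0// ltW.
have : ln y <= ln x + ln (1 + t / x).
  rewrite -lnM ?posrE//; last by rewrite ltr_wpDr.
  by rewrite ler_ln ?posrE ?mulr_gt0 ?ltr_wpDr// mulrDr mulr1 mulrC divfK ?gt_eqF.
have : ln (1 + t / x) <= t / x by apply: le_ln1Dx; lra.
have : t / x <= t / (s - t) by rewrite ler_wpM2l// lef_pV2 ?posrE.
lra.
Qed.

Lemma expr_small (q e : R) : 0 <= q -> q < 1 -> 0 < e -> exists2 n, (0 < n)%N & q ^+ n < e.
Proof.
move=> q0 q1 e0; have := @cvg_expr R q; rewrite ger0_norm// => /(_ q1).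
move=> /cvgrPdist_lt /(_ _ e0) [n _ nq].
exists n.+1 => //; have := nq n.+1 (leqnSn n).
by rewrite sub0r normrN ger0_norm// exprn_ge0.
Qed.

(* Newton's iteration for the inverse square root: [invsqrt_iter m s] is a
   polynomial in [s] increasing to [s^(-1/2)] on (0, 1]. *)
Fixpoint invsqrt_iter (A : comNzRingType) (h : A) (m : nat) (s : A) : A :=
  if m is m'.+1 then
    invsqrt_iter h m' s * (1 + h * (1 - s * invsqrt_iter h m' s ^+ 2))
  else 1.

Lemma invsqrt_iter_morph (A B : comNzRingType) (f : {rmorphism A -> B}) (h : A) m (s : A) :
  f (invsqrt_iter h m s) = invsqrt_iter (f h) m (f s).
Proof.
by elim: m => [|m IH] /=; rewrite ?rmorph1// rmorphM rmorphD rmorphM rmorphB rmorphM rmorphXn !rmorph1 IH.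
Qed.

Lemma invsqrt_iter_horner (A : comNzRingType) (h s : {poly A}) m z :
  (invsqrt_iter h m s).[z] = invsqrt_iter h.[z] m s.[z].
Proof.
elim: m => [|m IH] /=; first by rewrite hornerC.
by rewrite hornerM hornerD hornerM hornerD hornerN hornerM horner_exp !hornerC IH.
Qed.

(** With [x = t * q], one step turns [1 - x] into [(1 - x) * (1 - x / 2 - x ^+ 2 / 2)], and the
    second factor lies between 0 and [1 - t / 2] because [t <= x <= 1]. *)
Lemma invsqrt_iter_bounds (t : R) m : 0 <= t -> t <= 1 ->
  let q := invsqrt_iter 2^-1 m (t ^+ 2) in [/\ 1 <= q, t * q <= 1 &
    1 - t * q <= (1 - t / 2) ^+ m].
Proof.
move=> t0 t1; elim: m => [|m [q1 tq1 tqm]] /=.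
  by rewrite expr0 mulr1; split=> //; rewrite gerBl.
set q := invsqrt_iter _ _ _ in q1 tq1 tqm *.
set x := t * q in tq1 tqm.
have x0 : 0 <= x by rewrite mulr_ge0// (le_trans ler01).
have tx : t <= x by rewrite ler_peMr.
have hE : (2^-1 : R) = 1 / 2 by rewrite mul1r.
have -> : t ^+ 2 * q ^+ 2 = x ^+ 2 by rewrite /x; ring.
have xx : x ^+ 2 <= 1 by rewrite expr_le1.
have xE : t * (q * (1 + 2^-1 * (1 - x ^+ 2))) = 1 - (1 - x) * (1 - x / 2 - x ^+ 2 / 2).
  by rewrite mulrA -/x; field.
have y0 : 0 <= 1 - x / 2 - x ^+ 2 / 2 by lra.
rewrite xE; split.
- by rewrite (le_trans q1)// ler_peMr ?(le_trans ler01)// lerDl mulr_ge0 ?invr_ge0// subr_ge0.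
- by rewrite gerBl mulr_ge0// subr_ge0.
- have -> : 1 - (1 - (1 - x) * (1 - x / 2 - x ^+ 2 / 2)) =
    (1 - x / 2 - x ^+ 2 / 2) * (1 - x) by field.
  rewrite [leRHS]exprS; apply: ler_pM => //; first by rewrite subr_ge0.
  by have := sqr_ge0 x; lra.
Qed.

(** The last bound comes from [- ln x <= x^-1 - 1]; it sends [ln x] to 0 as [m] grows, for fixed
    [t]. The lower bound [ln t] does not depend on [m] and serves for dominated convergence. *)
Lemma ln_invsqrt_iter_le (t : R) m : 0 < t -> t <= 1 ->
  let x := t * invsqrt_iter 2^-1 m (t ^+ 2) in
  [/\ 0 < x, ln t <= ln x, ln x <= 0 & - ln x <= (1 - t / 2) ^+ m / t].
Proof.
move=> t0 t1 x; have [q1 tq1 tqm] := invsqrt_iter_bounds m (ltW t0) t1.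
have tx : t <= x by rewrite ler_peMr// ltW.
have x0 : 0 < x by exact: lt_le_trans tx.
split=> //; first by rewrite ler_ln ?posrE.
  by rewrite ln_le0.
have : ln x^-1 <= x^-1 - 1.
  by rewrite -{1}(subrKC 1 x^-1); apply: le_ln1Dx; rewrite ltrBrDl subrr invr_gt0.
rewrite lnV ?posrE// => h; apply: (le_trans h).
have -> : x^-1 - 1 = (1 - x) / x by field; rewrite gt_eqF.
by rewrite ler_pM ?subr_ge0 ?invr_ge0 ?(ltW x0)// lef_pV2 ?posrE.
Qed.

(** Here [J] is an energy, [a] the mass of a set $E$, [a1] the integral of the potential over $E$,
    [a2] the energy of the restriction to $E$, and [c] normalizes the measure after [s] times that
    restriction is added. The first-order gain [2 * s * a * e] beats the quadratic term, which is at
    most [s * a * (e - s)] because [s * J = e - s]. *)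
Lemma perturbed_energy_lt (J e a s c a1 a2 : R) :
  (0 <= J -> 0 < e -> 0 < a -> 0 < s -> s * (J + 1) = e -> 0 < c ->
   c * (1 + s * a) = 1 -> a1 <= (J - e) * a -> a2 <= a1 ->
   c * (c * (J + s * a1) + s * (c * (a1 + s * a2))) < J)%R.
Proof.
move=> J0 e0 a0 s0 sE c0 cc h1 h2.
have h2' : (a2 <= J * a)%R.
  by rewrite (le_trans h2)// (le_trans h1)// ler_wpM2r ?(ltW a0)// gerBl ltW.
have sa0 : (0 < s * a)%R by rewrite mulr_gt0.
have -> : (c * (c * (J + s * a1) + s * (c * (a1 + s * a2))) =
  c ^+ 2 * (J + 2 * s * a1 + s ^+ 2 * a2))%R by ring.
have {2}-> : (J = c ^+ 2 * (J * (1 + s * a) ^+ 2))%R.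
  by rewrite mulrCA -exprMn cc expr1n mulr1.
rewrite ltr_pM2l ?exprn_gt0//.
have k1 : (s * a1 <= s * ((J - e) * a))%R by rewrite ler_wpM2l// ltW.
have k2 : (s ^+ 2 * a2 <= s ^+ 2 * (J * a))%R by rewrite ler_wpM2l ?sqr_ge0.
have k3 : (0 <= J * (s * a) ^+ 2)%R by rewrite mulr_ge0 ?sqr_ge0.
have k4 : (0 < s * a * (e + s))%R by rewrite mulr_gt0// addr_gt0.
have k5 : (s ^+ 2 * (J * a) = s * a * (e - s))%R by rewrite -sE; ring.
have -> : (J * (1 + s * a) ^+ 2 = J + 2 * (s * a * J) + J * (s * a) ^+ 2)%R by ring.
have k6 : (s * ((J - e) * a) = s * a * J - s * a * e)%R by ring.
rewrite k6 in k1; rewrite k5 in k2.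
have k7 : (s * a * (e - s) = s * a * e - s * a * s)%R by ring.
have k8 : (s * a * (e + s) = s * a * e + s * a * s)%R by ring.
rewrite k7 in k2; rewrite k8 in k4.
rewrite -(mulrA 2%R s a1).
lra.
Qed.

(** The right-hand side is [(1 + e) * expR (n%:R * x) * b ^+ n]. In the application [b] bounds the
    diameter, [c] is the capacity and [x] an integrated logarithmic error. *)
Lemma sharp_bound (b c x e : R) n : 0 < b -> 0 < c -> 0 < e -> - (n%:R * x) <= ln (1 + e) ->
  b ^+ n <= (1 + e) * expR (n%:R * (x - (ln c - ln b))) * c ^+ n.
Proof.
move=> b0 c0 e0 h.
have e1 : 0 < 1 + e by rewrite addr_gt0.
have E (y : R) : 0 < y -> y ^+ n = expR (n%:R * ln y).
  by move=> y0; rewrite expRM_natl lnK.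
rewrite !E// -{1}(lnK (x := 1 + e)) ?posrE// -!expRD ler_expR !mulrBr.
by move: h; move: (n%:R * x) (n%:R * ln c) (n%:R * ln b) => *; lra.
Qed.

End RealEstimates.

Set Implicit Arguments.
Unset Strict Implicit.

(** * The complex plane with its real modulus: topology, measurability, polynomials *)

Section ComplexPlane.
Context {R : realType}.
Local Notation C := R[i].
Implicit Types (z u : C) (K : set C).

Lemma cmodE z : `|z| = (cmod z)%:C%C.
Proof. by rewrite normc_def; case: z. Qed.

Lemma cmod_ge0 z : 0 <= cmod z.
Proof. by case: z => a b; exact: sqrtr_ge0. Qed.

Lemma cmod_gt0 z : (0 < cmod z) = (z != 0).
Proof.
rewrite lt_neqAle cmod_ge0 andbT eq_sym; congr (~~ _).
by apply/eqP/eqP => [/ComplexField.Normc.eq0_normc //|->]; rewrite ComplexField.Normc.normc0.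
Qed.

Lemma cmodM z u : cmod (z * u) = cmod z * cmod u.
Proof. exact: ComplexField.Normc.normcM. Qed.

Lemma cmodX z n : cmod (z ^+ n) = cmod z ^+ n.
Proof.
elim: n => [|n IH]; first by rewrite !expr0 ComplexField.Normc.normc1.
by rewrite !exprS cmodM IH.
Qed.

Lemma cmodB z u : cmod (z - u) = cmod (u - z).
Proof. by rewrite -opprB normcN. Qed.

Lemma cmod_triangle v z u : cmod (z - u) <= cmod (z - v) + cmod (v - u).
Proof. by have := @le_normcD _ (z - v) (v - u); rewrite addrA subrK. Qed.

Lemma nbhs_cmodP z (A : set C) :
  nbhs z A <-> exists2 e : R, 0 < e & forall u, cmod (z - u) < e -> A u.
Proof.
split=> [/nbhs_ballP [e /= e0 eA]|[e e0 eA]]; last first.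
  apply/nbhs_ballP; exists (e%:C%C) => /=; first by rewrite ltcR.
  by move=> u; rewrite /ball/= cmodE ltcR; exact: eA.
(* The radius lives in [R[i]], where a positive element is real. *)
have eE : e = (complex.Re e)%:C%C.
  by move: e0; rewrite ltcE => /andP[/eqP]; case: (e) => a b /= ->.
exists (complex.Re e) => [|u zu]; first by rewrite -ltcR -eE.
by apply: eA; rewrite /ball/= cmodE eE ltcR.
Qed.

Lemma continuous_complex_measurable (f : C -> R) :
  continuous f -> measurable_fun setT f.
Proof.
move=> /continuousP cf; apply: (measurability _ (RGenOpens.measurableE R)).
move=> _ [_ [a [b ->] <-]]; rewrite setTI.
by apply: sub_sigma_algebra; apply: cf; exact: interval_open.
Qed.

Lemma complex_lip_continuous (k : R) (f : C -> R) :
  (forall z u, `|f z - f u| <= k * cmod (z - u)) -> continuous f.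
Proof.
move=> lf z; apply/(@cvgrPdist_le _ _ _ (nbhs z) (nbhs_filter z)) => /= e e0.
apply/nbhs_cmodP.
exists (e / (`|k| + 1)); first by rewrite divr_gt0// ltr_wpDl.
move=> u zu; apply: (le_trans (lf _ _)); rewrite ltr_pdivlMr ?ltr_wpDl// in zu.
apply: le_trans (ltW zu); rewrite mulrC ler_wpM2l ?cmod_ge0//.
by rewrite (le_trans (ler_norm k))// lerDl.
Qed.

Lemma Re_le_cmod z : `|complex.Re z| <= cmod z.
Proof. by have := normc_ge_Re z; rewrite cmodE lecR. Qed.

Lemma Im_le_cmod z : `|complex.Im z| <= cmod z.
Proof.
case: z => a b /=; rewrite -sqrtr_sqr; apply: ler_wsqrtr.
by rewrite lerDr sqr_ge0.
Qed.

Lemma Re_continuous : continuous (fun z : C => complex.Re z).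
Proof.
apply: (@complex_lip_continuous 1) => z u.
by rewrite mul1r; have := Re_le_cmod (z - u); case: z u => [a b] [c d].
Qed.

Lemma Im_continuous : continuous (fun z : C => complex.Im z).
Proof.
apply: (@complex_lip_continuous 1) => z u.
by rewrite mul1r; have := Im_le_cmod (z - u); case: z u => [a b] [c d].
Qed.

Lemma cmod_continuous : continuous (fun z : C => cmod z).
Proof.
apply: (@complex_lip_continuous 1) => z u; rewrite mul1r.
have := cmod_triangle u z 0; have := cmod_triangle z u 0.
by rewrite !subr0 (cmodB u z) ler_norml => *; lra.
Qed.

Lemma complex_closed_measurable (A : set C) : closed A -> measurable A.
Proof.
rewrite -openC => oA; rewrite -(setCK A); apply: measurableC.
exact: sub_sigma_algebra.
Qed.

Lemma complex_hausdorff : hausdorff_space C.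
Proof.
move=> z u zu; apply/eqP; rewrite -subr_eq0 -[_ == _]negbK -cmod_gt0.
apply/negP => d0.
have nz (v : C) : nbhs v [set t | cmod (v - t) < cmod (z - u) / 2].
  by apply/nbhs_cmodP; exists (cmod (z - u) / 2) => //; rewrite divr_gt0.
have [t [/= zt]] := zu _ _ (nz z) (nz u).
rewrite cmodB => ut; have := cmod_triangle t z u; lra.
Qed.

Lemma complex_compact_bounded K : compact K ->
  exists2 b : R, 0 < b & forall z, K z -> cmod z <= b.
Proof.
move=> cK; have : compact [set cmod z | z in K].
  by apply: continuous_compact => //; apply: continuous_subspaceT; exact: cmod_continuous.
move=> /compact_bounded [M [_ MK]].
exists (`|M| + 1); first by rewrite ltr_wpDl.
move=> z Kz; apply: le_trans (ler_norm _) _.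
by apply: MK => /=; [rewrite (le_lt_trans (ler_norm M))// ltrDl|exists z].
Qed.

Lemma measurable_dist (d : measure_display) (T : measurableType d) (f g : T -> C) :
  measurable_fun setT f -> measurable_fun setT g ->
  measurable_fun setT (fun t => cmod (f t - g t)).
Proof.
move=> mf mg.
have mRe := measurableT_comp (continuous_complex_measurable (@Re_continuous)).
have mIm := measurableT_comp (continuous_complex_measurable (@Im_continuous)).
rewrite (_ : (fun t => _) = fun t => Num.sqrt
    ((complex.Re (f t) - complex.Re (g t)) ^+ 2 +
     (complex.Im (f t) - complex.Im (g t)) ^+ 2)); last first.
  by apply/funext => t; case: (f t) (g t) => [a b] [c e].
apply: (measurableT_comp (continuous_measurable_fun (@sqrt_continuous R))).
by apply: measurable_funD; apply: measurable_funX; apply: measurable_funB;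
  [exact: mRe|exact: mRe|exact: mIm|exact: mIm].
Qed.

Lemma measurable_lne_fun (d : measure_display) (T : measurableType d) (D : set T) (f : T -> R) :
  measurable D -> measurable_fun D f -> measurable_fun D (fun t => lne (f t)%:E).
Proof.
move=> mD mf; rewrite /lne; apply: measurable_fun_if => //.
- by apply: measurable_fun_ler.
- apply: (measurable_funS mD); first exact: subIsetl.
  by apply/measurable_EFinP; exact: (measurableT_comp (@measurable_ln R)).
Qed.

(** The infimum of the distances may fail to be attained, [A] being arbitrary; points within a
    factor [k > 1] of it act as almost nearest points. *)
Lemma positive_distance (A : set C) z : A !=set0 ->
  ~ (forall e : R, 0 < e -> exists2 u, A u & cmod (z - u) < e) ->
  exists2 dlt : R, 0 < dlt & (forall u, A u -> dlt <= cmod (z - u)) /\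
    forall k : R, 1 < k -> exists2 u, A u & cmod (z - u) < k * dlt.
Proof.
move=> [u0 u0A] zA; pose D := [set cmod (z - u) | u in A].
have Dinf : has_inf D.
  split; first by exists (cmod (z - u0)), u0.
  by exists 0 => _ [u _ <-]; exact: cmod_ge0.
have i0 : 0 < inf D.
  rewrite ltNge; apply/negP => i0; apply: zA => e e0.
  have [_ [u uA <-] uD] := inf_adherent e0 Dinf.
  by exists u => //; apply: lt_le_trans uD _; rewrite gerDr.
exists (inf D); first exact: i0.
split=> [u uA|k k1]; first by apply: ge_inf; [case: Dinf|exists u].
have e0 : 0 < inf D * (k - 1) by rewrite mulr_gt0// subr_gt0.
have [_ [u uA <-] uD] := inf_adherent e0 Dinf.
exists u; first exact: uA.
by apply: (lt_le_trans uD); rewrite le_eqVlt; apply/orP; left; apply/eqP; ring.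
Qed.

Lemma lneE (x : R) : lne x%:E = if x <= 0 then -oo%E else (ln x)%:E.
Proof. by []. Qed.

Lemma cmod_real (x : R) : 0 <= x -> cmod (x%:C)%C = x.
Proof. by move=> x0; rewrite /ComplexField.Normc.normc/= expr0n/= addr0 sqrtr_sqr ger0_norm. Qed.

Lemma cmod_prod (rs : seq C) (F : C -> C) :
  cmod (\prod_(r <- rs) F r) = \prod_(r <- rs) cmod (F r).
Proof.
elim: rs => [|r rs IH]; first by rewrite !big_nil ComplexField.Normc.normc1.
by rewrite !big_cons cmodM IH.
Qed.

(** The roots are listed with multiplicity, so the length is [n] even when [u = 0]. *)
Lemma power_difference_roots (u : C) (n : nat) : (0 < n)%N ->
  exists rs : seq C, [/\ size rs = n, u \in rs,
    forall r, r \in rs -> cmod r = cmod u &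
    forall x, \prod_(r <- rs) (x - r) = x ^+ n - u ^+ n].
Proof.
move=> n0; pose p : {poly C} := 'X^n - (u ^+ n)%:P.
have pm : p \is monic by rewrite monicXnsubC.
have [rs] := closed_field_poly_normal p; rewrite (monicP pm) scale1r => pE.
have rootE r : (r \in rs) = (r ^+ n == u ^+ n).
  by rewrite -root_prod_XsubC -pE /root !hornerE subr_eq0.
exists rs; split=> [||r|x].
- have := size_prod_XsubC rs id; rewrite -pE size_XnsubC// => -[].
  by move=> ->.
- by rewrite rootE.
- rewrite rootE => /eqP /(congr1 (fun z : C => cmod z)); rewrite !cmodX => /eqP.
  by rewrite eqrXn2 ?cmod_ge0// => /eqP.
- transitivity p.[x]; last by rewrite !hornerE.
  by rewrite pE horner_prod; apply: eq_bigr => r _; rewrite !hornerE.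
Qed.

Lemma complex_square_compact (B : R) :
  compact [set z : C | `|complex.Re z| <= B /\ `|complex.Im z| <= B].
Proof.
pose f (p : R * R) : C := (p.1 +i* p.2)%C.
have fc : continuous f.
  move=> p A /nbhs_cmodP [e e0 eA].
  have e2 : 0 < e / 2 by rewrite divr_gt0.
  exists (ball p.1 (e / 2), ball p.2 (e / 2)) => /=.
    by split; exact: nbhsx_ballx.
  move=> q [q1 q2]; apply: eA.
  have -> : f p - f q = ((p.1 - q.1)%:C)%C - (- (((p.2 - q.2)%:C)%C * 'i%C)).
    by rewrite /f; apply/eqP; rewrite eq_complex /=; apply/andP; split; apply/eqP; ring.
  apply: le_lt_trans (cmod_triangle 0 _ _) _.
  rewrite subr0 sub0r opprK cmodM.
  have cr (x : R) : cmod (x%:C)%C = `|x|.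
    by rewrite /ComplexField.Normc.normc/= expr0n/= addr0 sqrtr_sqr.
  rewrite !cr [X in _ * X](_ : _ = 1) ?mulr1; last first.
    by rewrite /ComplexField.Normc.normc/= expr0n/= expr1n add0r sqrtr1.
  by rewrite (splitr e) ltrD.
have -> : [set z : C | `|complex.Re z| <= B /\ `|complex.Im z| <= B] =
    f @` (`[- B, B]%classic `*` `[- B, B]%classic).
  apply/seteqP; split=> [[a b] /= [aB bB]|_ [[a b] /= [aB bB] <-] /=].
    by exists (a, b) => //=; rewrite !in_itv/= -!ler_norml.
  by move: aB bB; rewrite !in_itv/= -!ler_norml.
apply: continuous_compact; first exact: continuous_subspaceT.
by apply: compact_setX; exact: segment_compact.
Qed.

(** Strict convexity of the disc, from the parallelogram law. *)
Lemma cmod_midpoint_eq (x y : C) (t : R) : cmod x = t -> cmod y = t ->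
  cmod (x + 2^-1 * (y - x)) = t -> x = y.
Proof.
have cE (z : C) : cmod z ^+ 2 = complex.Re z ^+ 2 + complex.Im z ^+ 2.
  by case: z => a b; rewrite sqr_sqrtr// addr_ge0 ?sqr_ge0.
have -> : 2^-1 = ((2^-1 : R)%:C)%C by rewrite fmorphV rmorph_nat.
move=> /(congr1 (fun t => t ^+ 2)) + /(congr1 (fun t => t ^+ 2)) +
  /(congr1 (fun t => t ^+ 2)); rewrite !cE.
case: x y => [a b] [c d] /=; rewrite !mul0r !subr0 !addr0.
set h := (2^-1 : R); have hE : 2 * h = 1 by rewrite divff.
move: (t ^+ 2) => s e1 e2 e3.
have : (a - c) ^+ 2 + (b - d) ^+ 2 = 0.
  have -> : (a - c) ^+ 2 + (b - d) ^+ 2 =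
    2 * (a ^+ 2 + b ^+ 2) + 2 * (c ^+ 2 + d ^+ 2)
    - ((2 * (a + h * (c - a))) ^+ 2 + (2 * (b + h * (d - b))) ^+ 2).
    have -> : 2 * (a + h * (c - a)) = a + c by rewrite mulrDr mulrA hE; ring.
    have -> : 2 * (b + h * (d - b)) = b + d by rewrite mulrDr mulrA hE; ring.
    ring.
  have -> : (2 * (a + h * (c - a))) ^+ 2 + (2 * (b + h * (d - b))) ^+ 2 = 4 * s.
    by rewrite -e3; ring.
  by rewrite e1 e2; ring.
move=> /eqP; rewrite paddr_eq0 ?sqr_ge0// !sqrf_eq0 !subr_eq0.
by move=> /andP[/eqP -> /eqP ->].
Qed.

(** Going from [x] towards the almost nearest point [v] by the fraction [(1 - l) / (1 + l)] of the
    way stays in the disc of radius [(1 - l) * d], hence at distance at least [l * d] from [A],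
    while coming within [2 * l * d] of [v]. *)
Lemma approach_point (A : set C) (x v : C) (d l : R) : 0 < d -> 0 < l -> l <= 1 / 2 ->
  (forall u, A u -> d <= cmod (x - u)) -> cmod (x - v) < (1 + l) * d ->
  exists u, [/\ cmod u <= (1 - l) * d, cmod (x + u - v) <= 2 * l * d &
    forall w, A w -> cmod (x + u - v) <= 2 * cmod (x + u - w)].
Proof.
move=> d0 l0 l1 xd xv.
have l1_gt0 : 0 < 1 + l by rewrite addr_gt0.
have q0 : 0 <= 1 - l by lra.
pose k := (1 - l) / (1 + l).
have k0 : 0 <= k by exact: divr_ge0 q0 (ltW l1_gt0).
have k1 : 1 - k = 2 * l / (1 + l) by rewrite /k; field; rewrite gt_eqF.
pose u : C := (k%:C)%C * (v - x).
have uE : cmod u = k * cmod (x - v) by rewrite cmodM cmod_real// cmodB.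
have ud : cmod u <= (1 - l) * d.
  rewrite uE /k mulrAC ler_pdivrMr// -mulrA ler_wpM2l// mulrC.
  exact: ltW.
have l2 : 0 <= 2 * l by exact: mulr_ge0 (ler0n _ _) (ltW l0).
have xuv : cmod (x + u - v) <= 2 * l * d.
  have -> : x + u - v = ((1 - k)%:C)%C * (x - v).
    by rewrite rmorphB rmorph1 /u; ring.
  have kk : 0 <= 1 - k by rewrite k1; exact: divr_ge0 l2 (ltW l1_gt0).
  rewrite cmodM cmod_real// k1 -[2 * l / _ * _]mulrA ler_wpM2l//.
  by rewrite mulrC ler_pdivrMr// mulrC ltW.
exists u; split=> // w wA.
have := xd _ wA; have := cmod_triangle (x + u) x w.
rewrite opprD addrA subrr add0r normcN.
move: xuv ud; rewrite mulrBl mul1r.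
move: (cmod _) (cmod u) (cmod _) (cmod _) => x1 x2 x3 x4 a1 a2 a3 a4.
apply: (le_trans a1); rewrite -mulrA ler_pM2l//; lra.
Qed.

(** The shape of the real and imaginary parts of a Horner step [p * 'X + c]. *)
Lemma continuous_bilinear (f g f' g' : C -> R) (c : R) :
  continuous f -> continuous g -> continuous f' -> continuous g' ->
  continuous (fun z => f z * g z + f' z * g' z + c : R).
Proof.
move=> cf cg cf' cg' z.
have h := @cvgM _ _ (nbhs z) (nbhs_filter z) f g _ _ (cf z) (cg z).
have h' := @cvgM _ _ (nbhs z) (nbhs_filter z) f' g' _ _ (cf' z) (cg' z).
exact: (cvgD (cvgD h h') (@cvg_cst _ c _ (nbhs z) (nbhs_filter z))).
Qed.

Lemma complex_poly_parts_continuous (p : {poly C}) :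
  continuous (fun z : C => complex.Re p.[z]) /\ continuous (fun z : C => complex.Im p.[z]).
Proof.
elim/poly_ind: p => [|p c [IHr IHi]].
  split.
    have -> : (fun z : C => complex.Re (0 : {poly C}).[z]) = cst 0.
      by apply/funext => z; rewrite horner0.
    exact: cst_continuous.
  have -> : (fun z : C => complex.Im (0 : {poly C}).[z]) = cst 0.
    by apply/funext => z; rewrite horner0.
  exact: cst_continuous.
have pE (z : C) : (p * 'X + c%:P).[z] = p.[z] * z + c by rewrite !hornerE.
split.
- have -> : (fun z : C => complex.Re (p * 'X + c%:P).[z]) =
     (fun z : C => complex.Re p.[z] * complex.Re z +
       complex.Im p.[z] * complex.Im (- z) + complex.Re c).
    apply/funext => z; rewrite pE.
    by clear pE; case: (p.[z]) => [a b]; case: z => [x y]; case: c => [s t] /=; rewrite mulrN.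
  apply: continuous_bilinear => //; first exact: Re_continuous.
  apply: (@complex_lip_continuous 1) => z u.
  by rewrite mul1r cmodB; have := Im_le_cmod (u - z); case: z u => [a b] [s t] /=; rewrite opprK addrC.
- have -> : (fun z : C => complex.Im (p * 'X + c%:P).[z]) =
     (fun z : C => complex.Re p.[z] * complex.Im z +
       complex.Im p.[z] * complex.Re z + complex.Im c).
    apply/funext => z; rewrite pE.
    by clear pE; case: (p.[z]) => [a b]; case: z => [x y]; case: c => [s t].
  by apply: continuous_bilinear => //; [exact: Im_continuous|exact: Re_continuous].
Qed.

Lemma monic_of_degree_roots n (P : {poly C}) : monic_of_degree n P ->
  exists2 rs : seq C, size rs = n & P = \prod_(r <- rs) ('X - r%:P).
Proof.
move=> [Pm sP]; have [rs PE] := closed_field_poly_normal P.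
rewrite (monicP Pm) scale1r in PE; exists rs => //.
by have := size_prod_XsubC rs id; rewrite -PE sP => -[].
Qed.

Lemma monic_of_degree_neq0 n (P : {poly C}) : monic_of_degree n P -> P != 0.
Proof. by move=> [/monic_neq0]. Qed.

Lemma monic_midpoint n (P Q : {poly C}) : monic_of_degree n P -> monic_of_degree n Q ->
  monic_of_degree n (P + 2^-1 *: (Q - P)).
Proof.
move=> [Pm sP] [Qm sQ].
have sD : (size (2^-1 *: (Q - P))%R < size P)%N.
  rewrite sP ltnS; apply: leq_trans (size_scale_leq _ _) _; apply/leq_sizeP => j.
  rewrite leq_eqVlt coefB => /orP[/eqP <-|nj]; last by rewrite !nth_default ?sP ?sQ ?subrr.
  move/monicP: Pm; move/monicP: Qm; rewrite !lead_coefE sP sQ /= => -> ->.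
  by rewrite subrr.
by split; [rewrite monicE lead_coefDl// -monicE|rewrite size_polyDl].
Qed.

End ComplexPlane.

(** * Real integrals over a probability space, with hypotheses almost everywhere *)

Section ProbabilityIntegral.
Set Implicit Arguments.
Unset Strict Implicit.
Context {d : measure_display} {T : measurableType d} {R : realType}.
Variable P : probability T R.
Implicit Types f g : T -> R.

Lemma integrable_cst (k : R) : P.-integrable setT (EFin \o cst k).
Proof. exact: finite_measure_integrable_cst. Qed.

Lemma prob_Rintegral_cst (k : R) : (\int[P]_x k)%R = k.
Proof. by rewrite Rintegral_cst// [X in fine X](probability_setT P) mulr1. Qed.

Lemma integrable_measurable f : P.-integrable setT (EFin \o f) -> measurable_fun setT f.
Proof. by move=> /measurable_int /measurable_EFinP. Qed.

Lemma integrable_Rintegral f : P.-integrable setT (EFin \o f) ->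
  (\int[P]_x (f x)%:E)%E = (\int[P]_x f x)%:E.
Proof. by move=> fi; rewrite fineK//; exact: integrable_fin_num. Qed.

Lemma ae_Rintegral_ge0 f : P.-integrable setT (EFin \o f) ->
  {ae P, forall x, 0 <= f x} -> 0 <= \int[P]_x f x.
Proof.
move=> fi f0; rewrite /Rintegral.
rewrite (@ae_eq_integral _ _ _ P setT (EFin \o (fun x => Num.max (f x) 0)) (EFin \o f)) //.
- apply: fine_ge0; apply: integral_ge0 => x _ /=.
  by rewrite lee_fin le_max lexx orbT.
- exact: measurable_int fi.
- apply/measurable_EFinP; apply: measurable_maxr => //.
  exact: integrable_measurable.
- by apply: filterS f0 => x fx0 _ /=; rewrite max_l.
Qed.

Lemma ae_le_Rintegral f g : P.-integrable setT (EFin \o f) ->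
  P.-integrable setT (EFin \o g) -> {ae P, forall x, f x <= g x} ->
  \int[P]_x f x <= \int[P]_x g x.
Proof.
move=> fi gi fg; rewrite -subr_ge0 -RintegralB//.
apply: ae_Rintegral_ge0; first exact: (integrableB measurableT gi fi).
by apply: filterS fg => x; rewrite subr_ge0.
Qed.

Lemma ae_eq_Rintegral_ge0 f : P.-integrable setT (EFin \o f) ->
  {ae P, forall x, 0 <= f x} -> \int[P]_x f x = 0 -> {ae P, forall x, f x = 0}.
Proof.
move=> fi f0 If.
have I0 : (\int[P]_x `|(EFin \o f) x|)%E = 0%E.
  transitivity (\int[P]_x (f x)%:E)%E; last by rewrite integrable_Rintegral// If.
  apply: ae_eq_integral => //.
  - by apply: measurableT_comp => //; exact: measurable_int fi.
  - exact: measurable_int fi.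
  - by apply: filterS f0 => x fx0 _ /=; rewrite ger0_norm.
have := (ae_eq_integral_abs P measurableT (measurable_int _ fi)).1 I0.
by apply: filterS => x /(_ I) [].
Qed.

Lemma ae_bounded_integrable f (M : R) : measurable_fun setT f ->
  {ae P, forall x, `|f x| <= M} -> P.-integrable setT (EFin \o f).
Proof.
move=> mf fM; apply/integrableP; split; first exact/measurable_EFinP.
apply: (@le_lt_trans _ _ (\int[P]_x (`|M|%:E))%E).
  apply: ae_ge0_le_integral => //.
  - by apply: measurableT_comp => //; exact/measurable_EFinP.
  - by apply: filterS fM => x fx _ /=; rewrite lee_fin (le_trans fx)// ler_norm.
by rewrite integral_cst//= probability_setT mule1 ltry.
Qed.

Lemma ae_between_integrable f g h : measurable_fun setT f ->
  P.-integrable setT (EFin \o g) -> P.-integrable setT (EFin \o h) ->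
  {ae P, forall x, g x <= f x} -> {ae P, forall x, f x <= h x} ->
  P.-integrable setT (EFin \o f).
Proof.
move=> mf gi hi gf fh.
have mfE : measurable_fun setT (EFin \o f) by exact/measurable_EFinP.
have ghi : P.-integrable setT (EFin \o (fun x => `|g x| + `|h x|)).
  exact: (integrableD measurableT (integrable_norm gi) (integrable_norm hi)).
apply/integrableP; split=> //.
apply: le_lt_trans (integrable_lty measurableT ghi).
apply: ae_ge0_le_integral => //.
- by apply: measurableT_comp.
- by move=> x _ /=; rewrite lee_fin addr_ge0.
- exact: measurable_int ghi.
- apply: filterS2 gf fh => x gx hx _ /=; rewrite lee_fin.
  have := ler_norm (- g x); have := ler_norm (h x); rewrite normrN => *.
  have := normr_ge0 (g x); have := normr_ge0 (h x); rewrite ler_norml => *; lra.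
Qed.

Lemma Rintegral_sum_seq (I : eqType) (s : seq I) (F : I -> T -> R) :
  (forall i, i \in s -> P.-integrable setT (EFin \o F i)) ->
  P.-integrable setT (EFin \o (fun x => \sum_(i <- s) F i x)) /\
  \int[P]_x (\sum_(i <- s) F i x) = \sum_(i <- s) \int[P]_x F i x.
Proof.
elim: s => [|i s IH] iF.
  split; last by under eq_Rintegral do rewrite big_nil; rewrite big_nil prob_Rintegral_cst.
  rewrite (_ : (fun x => _) = cst 0); first exact: integrable_cst.
  by apply/funext => x; rewrite big_nil.
have [|si sE] := IH; first by move=> j js; apply: iF; rewrite inE js orbT.
have ii : P.-integrable setT (EFin \o F i) by apply: iF; rewrite inE eqxx.
rewrite (_ : (fun x => _) = (fun x => F i x + \sum_(i <- s) F i x)); last first.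
  by apply/funext => x; rewrite big_cons.
split; first exact: (integrableD measurableT ii si).
rewrite [RHS]big_cons -sE -RintegralD//.
Qed.

Lemma ae_mem_full (A : set T) : measurable A -> P A = 1%E -> {ae P, forall x, A x}.
Proof.
move=> mA PA; exists (~` A); split=> //; first exact: measurableC.
by rewrite probability_setC// PA subee.
Qed.

Lemma ae_exists (Q : T -> Prop) : {ae P, forall x, Q x} -> exists x, Q x.
Proof.
move=> [N [mN N0 QN]]; apply: contrapT => /forallNP nQ.
have : P setT = 0%E.
  apply/eqP; rewrite eq_le measure_ge0 andbT -N0; apply: le_measure; rewrite ?inE//.
  by move=> x _; apply: QN => /=; exact: nQ.
by rewrite probability_setT => /eqP; rewrite onee_eq0.
Qed.

(** Dominated convergence, from which a single good index is extracted. *)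
Lemma exists_integral_near0 (U : nat -> T -> R) (g : T -> R) (e : R) : 0 < e ->
  (forall m, P.-integrable setT (EFin \o U m)) -> P.-integrable setT (EFin \o g) ->
  {ae P, forall z, forall m, `|U m z| <= g z} ->
  {ae P, forall z, U m z @[m --> \oo] --> (0 : R)} ->
  exists m, `|\int[P]_z U m z| < e.
Proof.
move=> e0 Ui gi Ug U0.
have [|||||_ _] := @dominated_convergence _ _ _ P setT measurableT
    (fun m => EFin \o U m) (cst 0%E) (EFin \o g).
- by move=> m; exact: measurable_int (Ui m).
- exact: measurable_cst.
- by apply: filterS U0 => z zU _; apply: cvg_EFin => //; exact: nearW.
- exact: gi.
- by apply: filterS Ug => z zU m _; rewrite lee_fin.
rewrite integral0 => /fine_cvgP [_] /cvgrPdist_lt /(_ _ e0) [m _ /(_ m (leqnn m))].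
by rewrite /= sub0r normrN => mU; exists m.
Qed.

End ProbabilityIntegral.

(** * Integrals of nonnegative functions and perturbations of a probability measure *)

Section NonnegativeIntegral.
Set Implicit Arguments.
Unset Strict Implicit.
Local Open Scope ereal_scope.
Context {d : measure_display} {T : measurableType d} {R : realType}.
Implicit Types (P : probability T R) (f : T -> \bar R).

Lemma ge0_integral_mrestr P (E : set T) (mE : measurable E) f :
  measurable_fun setT f -> (forall x, 0 <= f x) ->
  \int[mrestr P mE]_x f x = \int[P]_(x in E) f x.
Proof.
move=> mf f0.
rewrite (@ge0_negligible_integral _ _ _ _ setT (~` E))//; first last.
- by rewrite /= /mrestr setICl measure0.
- exact: measurableC.
rewrite setTD setCK; apply: eq_measure_integral => A mA AE.
by rewrite /= /mrestr setIidl.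
Qed.

(** The case of an infinite integral matters for measures of infinite energy: the positive part of
    [f - c] then still has integral [+oo], and the negative part has integral at most [|c|]. *)
Lemma integral_sub_cst P f (c : R) : measurable_fun setT f ->
  (forall x, 0 <= f x) -> \int[P]_x (f x - c%:E) = \int[P]_x f x - c%:E.
Proof.
move=> mf f0; have cI : \int[P]_x c%:E = c%:E :> \bar R.
  by rewrite integral_cst//= probability_setT mule1.
have [fi|] := ltP (\int[P]_x f x) +oo.
  rewrite -[in RHS]cI; apply: integralB => //.
    apply/integrableP; split=> //.
    by under eq_integral do rewrite gee0_abs//.
  exact: finite_measure_integrable_cst.
rewrite leye_eq => /eqP fy; rewrite fy addye//.
have mg : measurable_fun setT (fun x => f x - c%:E) by exact: emeasurable_funB.
rewrite integralE.
have posE : \int[P]_x (fun x => f x - c%:E)^\+ x + `|c|%:E =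
    \int[P]_x ((fun x => f x - c%:E)^\+ x + `|c|%:E).
  rewrite ge0_integralD//; last exact: measurable_funepos.
  by rewrite integral_cst//= probability_setT mule1.
have py : \int[P]_x (fun x => f x - c%:E)^\+ x = +oo.
  suff : \int[P]_x (fun x => f x - c%:E)^\+ x + `|c|%:E = +oo.
    by case: (\int[P]_x _) => //=.
  apply/eqP; rewrite -leye_eq -fy posE.
  apply: ge0_le_integral => //.
  - by apply: emeasurable_funD => //; exact: measurable_funepos.
  - move=> x _; rewrite -leeBlDr//; apply: (@le_trans _ _ (f x - c%:E)).
      by rewrite leeD2l// leeN2 lee_fin ler_norm.
    by rewrite funeposE le_max lexx.
have ny : \int[P]_x (fun x => f x - c%:E)^\- x <= `|c|%:E.
  apply: (@le_trans _ _ (\int[P]_x `|c|%:E)); last first.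
    by rewrite integral_cst//= probability_setT mule1.
  apply: ge0_le_integral => //; first exact: measurable_funeneg.
  move=> x _; rewrite funenegE ge_max lee_fin normr_ge0 andbT.
  rewrite oppeB; last by rewrite fin_num_adde_defl.
  rewrite addeC; apply: (@le_trans _ _ c%:E); last by rewrite lee_fin ler_norm.
  by rewrite geeDl// oppe_le0.
rewrite py; move: ny; case: (\int[P]_x _) => //=.
Qed.

Lemma probability_setI_full P (A E : set T) : measurable A -> measurable E ->
  P A = 1 -> P (A `&` E) = P E.
Proof.
move=> mA mE PA; rewrite (measureDI P mE mA) setIC.
rewrite [X in _ = X + _](_ : _ = 0) ?add0e//.
apply/eqP; rewrite eq_le measure_ge0 andbT.
have := probability_setC P mA; rewrite PA subee// => <-.
apply: le_measure => [||x []//]; rewrite inE.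
- exact: measurableD.
- exact: measurableC.
Qed.

(** Dividing by the total mass 1 changes nothing, but [mnormalize] carries the structure of a
    probability; [P] is its default for degenerate masses. *)
Lemma measure_probability P (m : {measure set T -> \bar R}) : m setT = 1 ->
  exists Q : probability T R, forall A, Q A = m A.
Proof.
move=> m1; exists (mnormalize m P) => A.
by rewrite /= /mnormalize m1 onee_eq0/= invr1 mule1.
Qed.

(** The competitor of the variational argument: add [s] times the restriction of [P] to [E], then
    renormalize. *)
Lemma perturb_probability P (E : set T) (s : R) : measurable E -> (0 <= s)%R ->
  exists Q : probability T R,
   (forall A, measurable A -> P A = 1 -> Q A = 1) /\
   forall f, measurable_fun setT f -> (forall x, 0 <= f x) ->
    \int[Q]_x f x =
    ((1 + s * fine (P E))^-1)%:E * (\int[P]_x f x + s%:E * \int[P]_(x in E) f x).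
Proof.
move=> mE s0; set a := fine (P E).
have a0 : (0 <= a)%R by apply: fine_ge0; exact: measure_ge0.
have sa0 : (0 < 1 + s * a)%R by rewrite ltr_wpDr// mulr_ge0.
have k0 : (0 <= (1 + s * a)^-1)%R by rewrite invr_ge0 ltW.
pose m : {measure set T -> \bar R} := mscale (NngNum k0) (measure_add P (mscale (NngNum s0) (mrestr P mE))).
have mEE A : m A = (((1 + s * a)^-1)%:E * (P A + s%:E * P (A `&` E))).
  rewrite -[LHS]/(((1 + s * a)^-1)%:E * measure_add P (mscale (NngNum s0) (mrestr P mE)) A).
  by rewrite measure_addE.
have PE : P E = a%:E by rewrite fineK// fin_num_measure.
have k1 : ((1 + s * a)^-1)%:E * (1 + s%:E * a%:E) = 1 :> \bar R.
  exact: (congr1 EFin (mulVf (negbT (gt_eqF sa0)))).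
have m1 : m setT = 1 by rewrite mEE setTI PE probability_setT.
have [Q QE] := measure_probability P m1.
exists Q; split=> [A mA PA|f mf f0].
  by rewrite QE mEE probability_setI_full// PA PE.
rewrite (eq_measure_integral m); last by move=> A _ _; exact: QE.
rewrite /m ge0_integral_mscale//; congr (_ * _).
rewrite ge0_integral_measure_add//; congr (_ + _).
by rewrite ge0_integral_mscale// ge0_integral_mrestr.
Qed.

(** * The potential of an energy minimizer is constant almost everywhere *)

Section EnergyMinimizer.
Variables (P : probability T R) (k : T * T -> \bar R) (J : R) (A : set T).
Hypotheses (mk : measurable_fun setT k) (k0 : forall p, 0 <= k p)
  (ksym : forall x y, k (x, y) = k (y, x)) (mA : measurable A) (PA : P A = 1)
  (kJ : \int[P]_x \int[P]_y k (x, y) = J%:E)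
  (minJ : forall Q : probability T R, Q A = 1 ->
    J%:E <= \int[Q]_x \int[Q]_y k (x, y)).

Let V x := \int[P]_y k (x, y).

Let V0 x : 0 <= V x. Proof. exact: integral_ge0. Qed.

Let mk1 x : measurable_fun setT (fun y => k (x, y)).
Proof. exact: (measurableT_comp mk (pair1_measurable x)). Qed.

Let mV : measurable_fun setT V.
Proof. exact: (measurable_fun_fubini_tonelli_F (m2 := P) k mk k0). Qed.

Let VE (E : set T) x := \int[P]_(y in E) k (x, y).

(** The cutoff to [E] is moved into the kernel so that Tonelli applies on the whole product. *)
Let hE (E : set T) (p : T * T) := k p * (\1_E p.2)%:E.

Let VEE E x : VE E x = \int[P]_y hE E (x, y).
Proof. by rewrite /VE integral_mkcond epatch_indic. Qed.

Let hE0 E p : 0 <= hE E p.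
Proof. by rewrite mule_ge0// lee_fin. Qed.

Let mhE E : measurable E -> measurable_fun setT (hE E).
Proof.
move=> mE; apply: emeasurable_funM => //; apply/measurable_EFinP.
by apply: (@measurableT_comp _ _ _ _ _ _ (\1_E : T -> R) _ snd);
  [exact: measurable_indic|exact: measurable_snd].
Qed.

Let mVE E : measurable E -> measurable_fun setT (VE E).
Proof.
move=> mE; rewrite (_ : VE E = fun x => \int[P]_y hE E (x, y)); last first.
  by apply/funext => x; exact: VEE.
exact: (measurable_fun_fubini_tonelli_F (m2 := P) (hE E) (mhE mE) (hE0 E)).
Qed.

Let VE0 E x : 0 <= VE E x. Proof. exact: integral_ge0. Qed.

(** Tonelli and the symmetry of [k]: both sides are the mutual energy of [P] and its restriction to
    [E]. *)
Let int_VE E : measurable E -> \int[P]_x VE E x = \int[P]_(x in E) V x.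
Proof.
move=> mE; under eq_integral do rewrite VEE.
rewrite (fubini_tonelli (m1 := P) (m2 := P) (hE E) (mhE mE) (hE0 E)).
rewrite [RHS]integral_mkcond epatch_indic; apply: eq_integral => y _.
rewrite /hE /= ge0_integralZr//.
- by congr (_ * _); apply: eq_integral => x _; rewrite ksym.
- by under eq_fun do rewrite ksym; exact: mk1.
Qed.

Let VE_le E x : measurable E -> VE E x <= V x.
Proof. by move=> mE; apply: ge0_subset_integral. Qed.

(** If the potential were at most [J - e] on a set of positive mass, putting slightly more mass
    there would bring the energy below the minimum [J]. *)
Let lowset_null (e : R) : (0 < e)%R -> P [set x | V x <= (J - e)%:E] = 0.
Proof.
move=> e0; set E := [set x | _].
have mE : measurable E by rewrite -[E]setTI; exact: emeasurable_fun_infty_c.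
have J0 : (0 <= J)%R by rewrite -lee_fin -kJ; apply: integral_ge0 => x _; exact: V0.
pose a := fine (P E).
have a0 : (0 <= a)%R by apply: fine_ge0; exact: measure_ge0.
have PE : P E = a%:E by rewrite fineK// fin_num_measure.
rewrite PE; congr EFin; apply/eqP; move: a0; rewrite le_eqVlt eq_sym.
move=> /orP[//|a0]; exfalso.
have I1 : \int[P]_(x in E) V x <= ((J - e) * a)%:E.
  apply: (@le_trans _ _ (\int[P]_(x in E) (J - e)%:E)).
    apply: ge0_le_integral => //; first exact: measurable_funTS.
  by rewrite integral_cst//= -[X in _ * X]/(P E) PE.
have I2 : \int[P]_(x in E) VE E x <= \int[P]_(x in E) V x.
  apply: ge0_le_integral => //; try exact: measurable_funTS.
  - by apply: measurable_funTS; exact: mVE.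
  - by move=> x _; exact: VE_le.
have [a1 a1E] : exists r, \int[P]_(x in E) V x = r%:E.
  exists (fine (\int[P]_(x in E) V x)); rewrite fineK// ge0_fin_numE ?integral_ge0//.
  exact: le_lt_trans I1 (ltry _).
rewrite a1E in I1 I2.
have [a2 a2E] : exists r, \int[P]_(x in E) VE E x = r%:E.
  exists (fine (\int[P]_(x in E) VE E x)); rewrite fineK// ge0_fin_numE ?integral_ge0//.
  exact: le_lt_trans I2 (ltry _).
rewrite a2E lee_fin in I2; rewrite lee_fin in I1.
(* Small enough for the term in [s ^+ 2] not to cancel the first-order gain. *)
have [s s0 sE] : exists2 s : R, (0 < s)%R & (s * (J + 1) = e)%R.
  by exists (e / (J + 1))%R; rewrite ?divr_gt0 ?ltr_wpDl// divfK// gt_eqF// ltr_wpDl.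
have [Q [QA Qint]] := perturb_probability P mE (ltW s0).
rewrite -/a in Qint.
have c0 : (0 < 1 + s * a)%R by rewrite ltr_wpDr// mulr_ge0// ltW.
have ci0 : (0 <= (1 + s * a)^-1)%R by rewrite invr_ge0 ltW.
pose c := ((1 + s * a)^-1)%R.
have mW : measurable_fun setT (fun x => c%:E * (V x + s%:E * VE E x)).
  apply: measurable_funeM; apply: emeasurable_funD => //.
  by apply: measurable_funeM; exact: mVE.
have W0 x : 0 <= c%:E * (V x + s%:E * VE E x).
  by rewrite mule_ge0 ?lee_fin// adde_ge0// mule_ge0// lee_fin ltW.
have mVs : measurable_fun setT (fun x => V x + s%:E * VE E x).
  by apply: emeasurable_funD => //; apply: measurable_funeM; exact: mVE.
have Vs0 x : 0 <= V x + s%:E * VE E x.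
  by rewrite adde_ge0// mule_ge0// lee_fin ltW.
have msV : measurable_fun setT (fun x => s%:E * VE E x).
  by apply: measurable_funeM; exact: mVE.
have sV0 x : 0 <= s%:E * VE E x by rewrite mule_ge0// lee_fin ltW.
have int_W D : measurable D -> \int[P]_(x in D) (c%:E * (V x + s%:E * VE E x)) =
    c%:E * (\int[P]_(x in D) V x + s%:E * \int[P]_(x in D) VE E x).
  move=> mD; rewrite ge0_integralZl_EFin//; last exact: measurable_funTS.
  congr (_ * _); rewrite ge0_integralD//; try exact: measurable_funTS.
  by rewrite ge0_integralZl_EFin//; [apply: measurable_funTS; exact: mVE|exact: ltW].
have := minJ (QA _ mA PA).
(* The energy of [Q]: the inner integral is [c * (V + s * VE E)]; the outer one splits into
   integrals over [setT] and over [E], both expanded by [int_W]. *)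
rewrite (eq_integral (fun x => c%:E * (V x + s%:E * VE E x))); last first.
  by move=> x _; rewrite Qint.
rewrite Qint// -/c !int_W// int_VE// kJ a1E a2E -!(EFinM, EFinD) lee_fin.
rewrite leNgt => /negP; apply; apply: (perturbed_energy_lt J0 e0 a0 s0 sE _ _ I1 I2).
- by rewrite invr_gt0.
- by rewrite mulVf// gt_eqF.
Qed.

(** Countably many null sets give [V >= J] almost everywhere; as [V - J] has integral 0, equality
    follows. *)
Lemma minimizer_potential_ae : {ae P, forall x, \int[P]_y k (x, y) = J%:E}.
Proof.
have VJ : {ae P, forall x, J%:E <= V x}.
  have : {ae P, forall x n, ~ (V x <= (J - n.+1%:R^-1)%:E)}.
    apply: ae_foralln => n; exists [set x | V x <= (J - n.+1%:R^-1)%:E]; split.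
    - by rewrite -[X in measurable X]setTI; exact: emeasurable_fun_infty_c.
    - by apply: lowset_null; rewrite invr_gt0.
    - by move=> x /= /contrapT.
  apply: filterS => x Vx; rewrite leNgt; apply/negP => VJ.
  have [r Vr] : exists r, V x = r%:E.
    exists (fine (V x)); rewrite fineK// ge0_fin_numE//; exact: lt_trans VJ (ltry _).
  move: VJ; rewrite Vr lte_fin -subr_gt0 => /ltr_add_invr [n]; rewrite add0r => nJ.
  by apply: (Vx n); rewrite Vr lee_fin lerBrDr -lerBrDl ltW.
have mVJ : measurable_fun setT (fun x => V x - J%:E) by exact: emeasurable_funB.
have : \int[P]_x `|V x - J%:E| = 0.
  transitivity (\int[P]_x (V x - J%:E)); last by rewrite integral_sub_cst// kJ subee.
  apply: ae_eq_integral => //; first exact: measurableT_comp.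
  by apply: filterS VJ => x Vx _; rewrite gee0_abs// sube_ge0.
move=> /(ae_eq_integral_abs P measurableT mVJ).
apply: filterS => x /(_ I); rewrite -/(V x).
by case: (V x) => [r| |] //= [/eqP]; rewrite subr_eq0 => /eqP ->.
Qed.

End EnergyMinimizer.

End NonnegativeIntegral.

(** * The logarithmic kernel made nonnegative *)

Section LogarithmicKernel.
Set Implicit Arguments.
Unset Strict Implicit.
Local Open Scope ereal_scope.
Context {R : realType}.
Local Notation C := R[i].
Local Arguments lne : simpl never.
Implicit Types (P : probability C R) (K : set C).

(** This is $\log(b/|z-\zeta|)$ cut off below at 0: nonnegative on the whole plane, equal to [+oo]
    on the diagonal, and unaffected by the cutoff on a set of diameter at most [b]. *)
Definition log_kernel (b : R) (p : C * C) : \bar R :=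
  - lne (Num.min 1%R (cmod (p.1 - p.2) / b)%R)%:E.

Lemma measurable_pair_dist :
  measurable_fun setT (fun p : C * C => cmod (p.1 - p.2)%R).
Proof.
by apply: measurable_dist; [exact: measurable_fst|exact: measurable_snd].
Qed.

Lemma measurable_log_dist (z : C) :
  measurable_fun setT (fun zeta : C => ln (cmod (z - zeta)%R)).
Proof.
apply: (measurableT_comp (@measurable_ln R)).
by apply: measurable_dist => //; exact: measurable_cst.
Qed.

Lemma measurable_log_kernel b : measurable_fun setT (log_kernel b).
Proof.
apply: measurableT_comp => //; apply: measurable_lne_fun => //.
apply: measurable_minr => //; apply: measurable_funM => //.
exact: measurable_pair_dist.
Qed.

Lemma log_kernel_ge0 b p : 0 <= log_kernel b p.
Proof. by rewrite oppe_ge0 lne_le0 lee_fin ge_min lexx. Qed.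

Lemma log_kernel_sym b (z u : C) : log_kernel b (z, u) = log_kernel b (u, z).
Proof. by rewrite /log_kernel /= cmodB. Qed.

Lemma log_kernelE b (z u : C) : (0 < b)%R -> (cmod (z - u) <= b)%R ->
  log_kernel b (z, u) = - lne (cmod (z - u)%R)%:E + (ln b)%:E.
Proof.
move=> b0 zub; rewrite /log_kernel /= min_r ?ler_pdivrMr ?mul1r//.
have [/eqP zu|zu] := boolP (z - u == 0)%R.
  by rewrite zu ComplexField.Normc.normc0 mul0r !lneE lexx.
have zu0 : (0 < cmod (z - u))%R by rewrite cmod_gt0.
rewrite !lne_EFin ?divr_gt0// ln_div ?posrE// -!EFinN -EFinD.
by congr EFin; rewrite opprB addrC.
Qed.

(** Tonelli covers nonnegative kernels, hence the split into positive and negative parts. *)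
Lemma measurable_potential P (f : C * C -> \bar R) : measurable_fun setT f ->
  measurable_fun setT (fun z => \int[P]_u f (z, u)).
Proof.
move=> mf; rewrite (_ : (fun z => _) = fun z =>
    \int[P]_u f^\+ (z, u) - \int[P]_u f^\- (z, u)); last first.
  apply/funext => z; rewrite integralE; congr (_ - _).
    by apply: eq_integral => u _; rewrite !funeposE.
  by apply: eq_integral => u _; rewrite !funenegE.
apply: emeasurable_funB.
- apply: (measurable_fun_fubini_tonelli_F (m2 := P) (f^\+)) => //.
  exact: measurable_funepos.
- apply: (measurable_fun_fubini_tonelli_F (m2 := P) (f^\-)) => //.
  exact: measurable_funeneg.
Qed.

(** On measures carried by [K] the two energies differ by a constant, so they have the same
    minimizers; infinite energies are covered. *)
Lemma energy_log_kernel P K b : measurable K -> P K = 1 -> (0 < b)%R ->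
  (forall z u, K z -> K u -> cmod (z - u) <= b)%R ->
  energy P = \int[P]_z \int[P]_u log_kernel b (z, u) - (ln b)%:E.
Proof.
move=> mK PK b0 Kb.
have Kae := ae_mem_full mK PK.
have mk z : measurable_fun setT (fun u => log_kernel b (z, u)).
  exact: (measurableT_comp (measurable_log_kernel b) (pair1_measurable z)).
rewrite -integral_sub_cst; last 2 first.
- by apply: measurable_potential; exact: measurable_log_kernel.
- by move=> z; apply: integral_ge0 => u _; exact: log_kernel_ge0.
have ml : measurable_fun setT (fun p : C * C => - lne (cmod (p.1 - p.2)%R)%:E).
  by apply: measurableT_comp => //; apply: measurable_lne_fun => //; exact: measurable_pair_dist.
rewrite /energy; apply: ae_eq_integral => //.
- exact: (measurable_potential P ml).
- by apply: emeasurable_funB => //; apply: measurable_potential; exact: measurable_log_kernel.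
apply: (filterS _ Kae) => z Kz _.
rewrite -integral_sub_cst//; last by move=> u; exact: log_kernel_ge0.
apply: ae_eq_integral => //.
- exact: (measurableT_comp ml (pair1_measurable z)).
- exact: emeasurable_funB.
by apply: filterS Kae => u Ku _; rewrite log_kernelE ?Kb// addeK.
Qed.

End LogarithmicKernel.

(** * The potential of the equilibrium measure *)

Section Frostman.
Set Implicit Arguments.
Unset Strict Implicit.
Context {R : realType}.
Local Notation C := R[i].
Local Arguments lne : simpl never.
Variables (K : set C) (rho : probability C R).
Hypotheses (cK : compact K) (capK : 0 < cap K) (rhoE : is_equilibrium_measure K rho).

Let rhoK : rho K = 1%E. Proof. by case: rhoE. Qed.

Lemma compact_complex_measurable : measurable K.
Proof. by apply: complex_closed_measurable; apply: compact_closed => //; exact: complex_hausdorff. Qed.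

Let mK := compact_complex_measurable.

Lemma energy_equilibrium : energy rho = (- ln (cap K))%:E.
Proof.
have : energy rho = ereal_inf [set energy mu | mu in
    [set mu : probability C R | mu K = 1%E]].
  apply/eqP; rewrite eq_le; apply/andP; split.
    by apply: le_ereal_inf_tmp => _ [mu /= muK <-]; case: rhoE => _; exact.
  by apply: ereal_inf_lbound; exists rho.
(* An infinite infimum would give [cap K = 0]: [expeR -oo] is 0, and [fine] sends [+oo] to 0. *)
move=> ->; move: capK; rewrite /cap; case: (ereal_inf _) => [r| |] /=.
- by rewrite expRK opprK.
- by rewrite ltxx.
- by rewrite ltxx.
Qed.

Lemma ae_mem_compact : {ae rho, forall z, K z}.
Proof. exact: ae_mem_full. Qed.

Lemma compact_diameter : exists2 b : R, 0 < b &
  forall z u, K z -> K u -> cmod (z - u) <= b.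
Proof.
have [b b0 Kb] := complex_compact_bounded cK.
exists (b + b) => [|z u Kz Ku]; first exact: addr_gt0.
apply: le_trans (cmod_triangle 0 z u) _.
by rewrite subr0 sub0r normcN lerD// Kb.
Qed.

Lemma equilibrium_log_kernel_ae (b : R) : 0 < b ->
  (forall z u, K z -> K u -> cmod (z - u) <= b) ->
  {ae rho, forall z, (\int[rho]_u log_kernel b (z, u))%E = (ln b - ln (cap K))%:E}.
Proof.
move=> b0 Kb; apply: (@minimizer_potential_ae _ _ _ rho (log_kernel b) _ K) => //.
- exact: measurable_log_kernel.
- exact: log_kernel_ge0.
- exact: log_kernel_sym.
- have := energy_log_kernel mK rhoK b0 Kb; rewrite energy_equilibrium.
  by case: (\int[rho]_z _)%E => //= r [rE]; congr EFin; lra.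
- move=> Q QK; have := rhoE.2 _ QK; rewrite energy_equilibrium.
  by rewrite (energy_log_kernel mK QK b0 Kb) leeBrDr// -EFinD addrC.
Qed.

Definition log_potential (z : C) : R := \int[rho]_u ln (cmod (z - u)).

(** Integrability alone would not exclude an atom at [z], because [ln 0 = 0]; the first clause does,
    and makes [log_potential z] the true potential. *)
Definition log_regular (z : C) : Prop := {ae rho, forall u, z != u} /\
  rho.-integrable setT (EFin \o (fun u : C => ln (cmod (z - u)))).

(** The kernel is [+oo] at [u = z], so a finite integral forces [z] to be [rho]-null; elsewhere the
    kernel is [ln b - ln (cmod (z - u))] almost everywhere. *)
Lemma log_regular_kernel (b : R) (z : C) (M : R) : 0 < b -> {ae rho, forall u, cmod (z - u) <= b} ->
  (\int[rho]_u log_kernel b (z, u) <= M%:E)%E ->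
  log_regular z /\
  (\int[rho]_u log_kernel b (z, u))%E = (ln b - log_potential z)%:E.
Proof.
move=> b0 zb kM.
have mk : measurable_fun setT (fun u => log_kernel b (z, u)).
  exact: (measurableT_comp (measurable_log_kernel b) (pair1_measurable z)).
have ki : rho.-integrable setT (fun u => log_kernel b (z, u)).
  apply/integrableP; split => //.
  under eq_integral do rewrite gee0_abs ?log_kernel_ge0//.
  exact: le_lt_trans kM (ltry _).
have zu : {ae rho, forall u, z != u}.
  apply: filterS (integrable_ae measurableT ki) => u /(_ I).
  apply: contraL => /eqP <-; rewrite /log_kernel/= subrr ComplexField.Normc.normc0 mul0r.
  by rewrite min_r// lneE lexx.
have E : {ae rho, forall u, log_kernel b (z, u) = (ln b - ln (cmod (z - u)))%:E}.
  apply: filterS2 zb zu => u ub zu; rewrite log_kernelE// lne_EFin ?cmod_gt0 ?subr_eq0//.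
  by rewrite -EFinN -EFinD addrC.
have mlb : measurable_fun setT (fun u : C => ln b - ln (cmod (z - u))).
  by apply: measurable_funB => //; exact: measurable_log_dist.
have Iint : (\int[rho]_u (ln b - ln (cmod (z - u)))%:E)%E = (\int[rho]_u log_kernel b (z, u))%E.
  apply: ae_eq_integral => //; first exact/measurable_EFinP.
  by apply: filterS E => u -> _.
have i1 : rho.-integrable setT (EFin \o (fun u : C => ln b - ln (cmod (z - u)))).
  apply/integrableP; split; first exact/measurable_EFinP.
  rewrite (@ae_eq_integral _ _ _ rho setT (fun u => log_kernel b (z, u)))//.
  - exact: le_lt_trans kM (ltry _).
  - by apply: measurableT_comp => //; exact/measurable_EFinP.
  - apply: filterS E => u Eu _; have := log_kernel_ge0 b (z, u).
    by rewrite Eu lee_fin /= => h; rewrite ger0_norm.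
have i2 : rho.-integrable setT (EFin \o (fun u : C => ln (cmod (z - u)))).
  have := integrableB measurableT (integrable_cst rho (ln b)) i1.
  by apply: eq_integrable => // u _; rewrite /= -EFinB; congr EFin; lra.
split; first by split.
rewrite -Iint integrable_Rintegral// RintegralB//; last exact: integrable_cst.
by rewrite prob_Rintegral_cst.
Qed.

Lemma log_regular_far (d : R) (z : C) : 0 < d -> {ae rho, forall u, d <= cmod (z - u)} -> log_regular z.
Proof.
move=> d0 zd; split.
  apply: filterS zd => u zu; rewrite -subr_eq0 -cmod_gt0; exact: lt_le_trans zu.
have [b b0 Kb] := complex_compact_bounded cK.
apply: (@ae_between_integrable _ _ _ rho _ (cst (ln d)) (cst (ln (cmod z + b)))).
- exact: measurable_log_dist.
- exact: integrable_cst.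
- exact: integrable_cst.
- apply: filterS zd => u zu; rewrite /= ler_ln ?posrE//; exact: lt_le_trans zu.
- apply: filterS2 zd ae_mem_compact => u zu Ku /=.
  have d1 := lt_le_trans d0 zu.
  have d2 : cmod (z - u) <= cmod z + b.
    by apply: le_trans (cmod_triangle 0 z u) _; rewrite subr0 sub0r normcN lerD2l Kb.
  by rewrite ler_ln ?posrE//; exact: lt_le_trans d2.
Qed.

(** * Frostman's lower bound, with [b] a bound for the diameter of [K] *)

Section MaximumPrinciple.
Variable b : R.
Hypotheses (b0 : 0 < b) (Kb : forall z u, K z -> K u -> cmod (z - u) <= b).

Let M := ln b - ln (cap K).

(** The points of [K] with [ln (cap K) <= log_potential z], expressed by the extended kernel so as
    to make sense before integrability is known and to allow a semicontinuity argument. *)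
Definition low_set : set C :=
  [set z | K z /\ (\int[rho]_u log_kernel b (z, u) <= M%:E)%E].

Lemma low_set_ae : {ae rho, forall z, low_set z}.
Proof.
apply: filterS2 ae_mem_compact (equilibrium_log_kernel_ae b0 Kb) => z Kz zM.
by split=> //; rewrite zM.
Qed.

Lemma low_set_dist_ae z : low_set z -> {ae rho, forall u, cmod (z - u) <= b}.
Proof. by move=> [Kz _]; apply: filterS ae_mem_compact => u; exact: Kb. Qed.

Lemma low_set_potential z : low_set z -> log_regular z /\ ln (cap K) <= log_potential z.
Proof.
move=> zF; have [zr zE] := log_regular_kernel b0 (low_set_dist_ae zF) zF.2.
by split=> //; move: zF.2; rewrite zE lee_fin lerD2l lerN2.
Qed.

Lemma log_kernel_bound_ge0 : 0 <= M.
Proof.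
have [z [_ zM]] := ae_exists low_set_ae.
by rewrite -lee_fin; apply: le_trans zM; apply: integral_ge0 => u _; exact: log_kernel_ge0.
Qed.

(** If the scaled distance at [z'] is at most [expR (- n%:R)], the kernel at [z'] already exceeds
    [n]. Otherwise the displacement is small relative to that distance, which is thus at most
    [1 + e] times the one at [z]. *)
Lemma truncated_log_kernel_le (z z' u : C) (n : nat) (e : R) : 0 < e ->
  cmod (z - z') < b * (expR (- n%:R) * (e / (1 + e))) ->
  (mine (log_kernel b (z, u)) n%:R%:E <= log_kernel b (z', u) + e%:E)%E.
Proof.
move=> e0 zz'; rewrite /log_kernel /=.
set x := Num.min 1 (cmod (z - u) / b); set x' := Num.min 1 (cmod (z' - u) / b).
set h := expR (- n%:R) * (e / (1 + e)).
have xx' : x' <= x + h.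
  rewrite /x; case: (leP 1 (cmod (z - u) / b)) => _.
    rewrite /x' ge_min lerDl; apply/orP; left.
    by rewrite mulr_ge0 ?expR_ge0// divr_ge0// ltW// addr_gt0.
  rewrite /x' ge_min; apply/orP; right.
  rewrite ler_pdivrMr// mulrDl divfK ?gt_eqF// [h * b]mulrC.
  by apply: le_trans (cmod_triangle z _ _) _; rewrite (cmodB z') addrC lerD2l ltW.
have [x0|x0] := leP x' 0; first by rewrite (lneE x') x0/= leey.
rewrite (lne_EFin x0).
have [xn|xn] := leP x' (expR (- n%:R)).
  apply: (@le_trans _ _ n%:R%:E); first by rewrite ge_min lexx orbT.
  rewrite lee_fin; apply: (@le_trans _ _ (- ln x')); last by rewrite lerDl ltW.
  by rewrite lerNr -(expRK (- n%:R)) ler_ln ?posrE ?expR_gt0.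
have e1 : 0 < 1 + e by rewrite addr_gt0.
have hx' : h * (1 + e) <= x' * e.
  by rewrite /h mulrA divfK ?gt_eqF// ler_wpM2r ?ltW.
have xe : x' <= x * (1 + e).
  have : (x' - h) * (1 + e) <= x * (1 + e) by rewrite ler_wpM2r ?(ltW e1)// lerBlDr.
  rewrite mulrBl mulrDr mulr1; lra.
have x_gt0 : 0 < x by move: (lt_le_trans x0 xe); rewrite pmulr_lgt0.
rewrite ge_min (lne_EFin x_gt0) !(=^~ EFinN, =^~ EFinD) !lee_fin; apply/orP; left.
have : ln x' <= ln x + ln (1 + e) by rewrite -lnM ?posrE// ler_ln ?posrE// mulr_gt0.
have : ln (1 + e) <= e by apply: le_ln1Dx; lra.
lra.
Qed.

(** Each truncation at height [n] inherits the bound from nearby points of [low_set]; monotone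
    convergence in [n] then gives it for the full kernel. *)
Lemma low_set_closed z :
  (forall e, 0 < e -> exists2 z', low_set z' & cmod (z - z') < e) -> low_set z.
Proof.
move=> zF; split.
  apply: (compact_closed complex_hausdorff cK) => A /nbhs_cmodP[e e0 eA].
  by have [z' [Kz' _] zz'] := zF _ e0; exists z'; split=> //; exact: eA.
have mk (v : C) : measurable_fun setT (fun u => log_kernel b (v, u)).
  exact: (measurableT_comp (measurable_log_kernel b) (pair1_measurable v)).
pose g n u := mine (log_kernel b (z, u)) n%:R%:E.
have mg n : measurable_fun setT (g n) by exact: measurable_mine.
have g0 n u : (0 <= g n u)%E by rewrite le_min log_kernel_ge0 lee_fin ler0n.
have gM n : (\int[rho]_u g n u <= M%:E)%E.
  apply/lee_addgt0Pr => e e0.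
  have h0 : 0 < b * (expR (- n%:R) * (e / (1 + e))).
    by rewrite mulr_gt0// mulr_gt0 ?expR_gt0// divr_gt0// addr_gt0.
  have [z' [_ z'M] zz'] := zF _ h0.
  apply: (@le_trans _ _ (\int[rho]_u (log_kernel b (z', u) + e%:E))%E).
    apply: ge0_le_integral => //; first exact: emeasurable_funD.
    by move=> u _; exact: truncated_log_kernel_le.
  rewrite ge0_integralD//; [|by move=> u _; exact: log_kernel_ge0|by move=> u _; rewrite lee_fin ltW].
  by rewrite integral_cst//= probability_setT mule1 leeD2r.
have gcvg u : (g n u @[n --> \oo] --> log_kernel b (z, u))%E.
  have := log_kernel_ge0 b (z, u); rewrite /g.
  case: (log_kernel b (z, u)) => [r| |]// _.
  - apply: cvg_near_cst; exists (Num.truncn r).+1 => // n /= rn.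
    by rewrite min_l// lee_fin; apply/ltW/(lt_le_trans (truncnS_gt _)); rewrite ler_nat.
  - under eq_fun do rewrite min_r ?leey//.
    exact/cvgeryP/cvgr_idn.
have gE : (\int[rho]_u (limn (g^~ u)) = \int[rho]_u log_kernel b (z, u))%E.
  by apply: eq_integral => u _; apply/cvg_lim => //; exact: gcvg.
have cv : (\int[rho]_u g n u)%E @[n --> \oo] --> (\int[rho]_u (limn (g^~ u)))%E.
  apply: cvg_monotone_convergence => // u _ n m nm.
  by rewrite /g le_min !ge_min lexx/= lee_fin ler_nat nm orbT.
rewrite -gE -(cvg_lim _ cv)//; apply: lime_le; first exact: cvgP cv.
exact: nearW.
Qed.

Lemma low_set_near z : ~ low_set z -> exists2 dlt : R, 0 < dlt &
  (forall u, low_set u -> dlt <= cmod (z - u)) /\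
  forall k : R, 1 < k -> exists2 u, low_set u & cmod (z - u) < k * dlt.
Proof.
move=> zF; apply: positive_distance; first exact: ae_exists low_set_ae.
by move=> /low_set_closed.
Qed.

(** On [low_set] the kernel integral is finite; off it, the distance to [low_set], a set of full
    measure, is positive. *)
Lemma all_log_regular z : log_regular z.
Proof.
have [zF|/low_set_near [d d0 [zd _]]] := pselect (low_set z).
  by have [] := low_set_potential zF.
by apply: (log_regular_far d0); apply: filterS low_set_ae => u; exact: zd.
Qed.

Lemma log_potential_integrable z :
  rho.-integrable setT (EFin \o (fun u : C => ln (cmod (z - u)))).
Proof. by case: (all_log_regular z). Qed.

Lemma ae_neq z : {ae rho, forall u, z != u}.
Proof. by case: (all_log_regular z). Qed.

Lemma ball_indic_integrable z s :
  rho.-integrable setT (EFin \o (fun u : C => \1_[set v : C | cmod (z - v) < s] u : R)) .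
Proof.
apply: (@ae_bounded_integrable _ _ _ rho _ 1).
  apply: measurable_indic; rewrite -[X in measurable X]setTI.
  have m : measurable_fun setT (fun v : C => cmod (z - v)).
    by apply: measurable_dist => //; exact: measurable_cst.
  have := m measurableT `]-oo, s[%classic (measurable_itv _).
  by congr (measurable _); apply/seteqP; split=> v; rewrite /= in_itv.
by apply: aeW => u; rewrite indicE; case: (_ \in _); rewrite ?normr1 ?normr0.
Qed.

(** Markov's inequality: the kernel is at least [ln b - ln s] on the ball. The mass of small balls
    is thus uniformly small over [low_set]. *)
Lemma low_set_ball z s : low_set z -> 0 < s -> s < b ->
  (ln b - ln s) * \int[rho]_u \1_[set v : C | cmod (z - v) < s] u <= M.
Proof.
move=> zF s0 sb; have [[zu zi] zc] := low_set_potential zF.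
rewrite -RintegralZl//; last exact: ball_indic_integrable.
have i1 := integrableB measurableT (integrable_cst rho (ln b)) zi.
apply: (@le_trans _ _ (\int[rho]_u (ln b - ln (cmod (z - u))))); last first.
  rewrite RintegralB//; last exact: integrable_cst.
  by rewrite prob_Rintegral_cst /M lerD2l lerN2.
apply: ae_le_Rintegral.
- exact: (integrableZl measurableT (ln b - ln s) (ball_indic_integrable z s)).
- exact: i1.
apply: filterS2 zu (low_set_dist_ae zF) => u zu ub.
have d0 : 0 < cmod (z - u) by rewrite cmod_gt0 subr_eq0.
rewrite indicE; case: (boolP (u \in _)) => [|_]; rewrite ?mulr1 ?mulr0.
  by rewrite inE /= => us; rewrite lerD2l lerN2 ler_ln ?posrE// ltW.
by rewrite subr_ge0 ler_ln ?posrE.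
Qed.

(** The potentials at [z] and at [v] are compared under the integral. On the ball of radius [s]
    about [v] the distances have ratio at most 3, and the ball has small mass; outside it
    [log_le_add] applies. *)
Lemma log_potential_near z v s : low_set v ->
  (forall u, low_set u -> cmod (z - v) <= 2 * cmod (z - u)) ->
  cmod (z - v) < s -> s < b ->
  ln (cap K) <= log_potential z + ln 3 * (M / (ln b - ln s)) +
    cmod (z - v) / (s - cmod (z - v)).
Proof.
move=> vF zv vs sb; set t := cmod (z - v).
have t0 : 0 <= t by exact: cmod_ge0.
have s0 : 0 < s by exact: le_lt_trans vs.
have [[vu vi] vc] := low_set_potential vF.
set beta := \int[rho]_u \1_[set w : C | cmod (v - w) < s] u : R.
have lbs : 0 < ln b - ln s by rewrite subr_gt0 ltr_ln ?posrE.
have betaM : beta <= M / (ln b - ln s).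
  by rewrite ler_pdivlMr// mulrC; exact: low_set_ball.
have ln3 : 0 <= ln 3 :> R by rewrite ln_ge0// ler1n.
apply: (le_trans vc).
apply: (@le_trans _ _ (log_potential z + ln 3 * beta + t / (s - t))); last first.
  by rewrite lerD2r lerD2l ler_wpM2l.
rewrite /beta -(RintegralZl (ln 3) measurableT (ball_indic_integrable v s)).
have i1 := integrableZl measurableT (ln 3) (ball_indic_integrable v s).
have i2 := integrableD measurableT (log_potential_integrable z) i1.
rewrite -RintegralD//; last exact: log_potential_integrable.
rewrite -{1}(prob_Rintegral_cst rho (t / (s - t))) -RintegralD//; last exact: integrable_cst.
apply: ae_le_Rintegral => //.
  exact: (integrableD measurableT i2 (integrable_cst rho (t / (s - t)))).
apply: filterS3 (ae_neq z) vu low_set_ae => u zu vu uF.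
have d0 : 0 < cmod (z - u) by rewrite cmod_gt0 subr_eq0.
have d1 : 0 < cmod (v - u) by rewrite cmod_gt0 subr_eq0.
have tri : cmod (v - u) <= cmod (z - u) + t.
  by apply: le_trans (cmod_triangle z _ _) _; rewrite (cmodB v) addrC.
have ts : 0 <= t / (s - t) by rewrite divr_ge0// subr_ge0 ltW.
rewrite indicE; case: (boolP (u \in _)) => us; rewrite ?mulr1 ?mulr0 ?addr0.
  (* In the ball, $|v-u| \le |z-u| + |z-v| \le 3|z-u|$. *)
  apply: (@le_trans _ _ (ln (cmod (z - u)) + ln 3)); last by rewrite lerDl.
  rewrite -lnM ?posrE// ler_ln ?posrE ?mulr_gt0// (le_trans tri)//.
  by have := zv _ uF; rewrite -/t; lra.
move: us; rewrite notin_setE /= => /negP; rewrite -leNgt => su.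
exact: log_le_add tri.
Qed.

(** A crude bound, making the infimum of the potential finite. For [v] within twice the distance
    from [z] to [low_set], $|v-u| \le 3|z-u|$ for every [u] in [low_set]. *)
Lemma log_potential_weak z : ln (cap K) - ln 3 <= log_potential z.
Proof.
have ln3 : 0 <= ln 3 :> R by rewrite ln_ge0// ler1n.
have [zF|/low_set_near [d d0 [zd /(_ 2)]]] := pselect (low_set z).
  have [_ zc] := low_set_potential zF.
  by apply: le_trans zc; rewrite gerDl oppr_le0.
rewrite ltr1n => /(_ isT) [v vF zv].
have [[vu vi] vc] := low_set_potential vF.
apply: (le_trans (lerB vc (lexx _))).
rewrite -{1}(prob_Rintegral_cst rho (ln 3)) -RintegralB//; last exact: integrable_cst.
apply: ae_le_Rintegral.
- exact: (integrableB measurableT vi (integrable_cst rho (ln 3))).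
- exact: log_potential_integrable.
apply: filterS2 vu low_set_ae => u vu uF.
have d1 := lt_le_trans d0 (zd _ uF).
have d2 : 0 < cmod (v - u) by rewrite cmod_gt0 subr_eq0.
rewrite lerBlDr -lnM ?posrE// ler_ln ?posrE ?mulr_gt0//.
apply: (le_trans (cmod_triangle z v u)); rewrite (cmodB v).
move: (zd _ uF) zv; move: (cmod _) (cmod _) => x y *; lra.
Qed.

Lemma log_potential_near_uniform (e : R) : 0 < e -> exists2 eta : R, 0 < eta &
  forall z v, low_set v ->
  (forall u, low_set u -> cmod (z - v) <= 2 * cmod (z - u)) ->
  cmod (z - v) < eta -> ln (cap K) <= log_potential z + e.
Proof.
move=> e0; have ln3 : 0 < ln 3 :> R by rewrite ln_gt0// ltr1n.
have M0 := log_kernel_bound_ge0.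
(* [s] is such that [ln b - ln s = L], and [L] makes the contribution of the ball at most [e / 2];
   the radius [eta] below does the same for the outside. *)
pose L := 2 * ln 3 * M / e + 1.
have L0 : 0 < L by rewrite ltr_wpDl// divr_ge0 ?mulr_ge0// ltW.
pose s := b * expR (- L).
have s0 : 0 < s by rewrite mulr_gt0 ?expR_gt0.
have sb : s < b by rewrite gtr_pMr// -expR0 ltr_expR oppr_lt0.
have lnL : ln b - ln s = L by rewrite /s lnM ?posrE ?expR_gt0// expRK opprD addNKr opprK.
have e2 : 0 < 2 + e by rewrite addr_gt0.
exists (e * s / (2 + e)); first by rewrite divr_gt0// mulr_gt0.
move=> z v vF zv; rewrite ltr_pdivlMr// => ze.
have t0 := cmod_ge0 (z - v).
have ts : cmod (z - v) < s.
  rewrite -(ltr_pM2r e2); apply: (lt_le_trans ze).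
  by rewrite mulrC ler_wpM2l ?(ltW s0)// lerDr.
apply: (le_trans (log_potential_near vF zv ts sb)); rewrite lnL -addrA lerD2l.
have k1 : ln 3 * (M / L) <= e / 2.
  rewrite mulrA ler_pdivrMr// /L (mulrDr (e / 2)) mulr1.
  have -> : e / 2 * (2 * ln 3 * M / e) = ln 3 * M by field; rewrite gt_eqF.
  by rewrite lerDl divr_ge0// ltW.
have k2 : cmod (z - v) / (s - cmod (z - v)) <= e / 2.
  move: ts ze; move: (cmod _) => t ts ze.
  by rewrite ler_pdivrMr ?subr_gt0//; lra.
by move: k1 k2; move: (ln 3 * _) (_ / (s - _)) => x y *; lra.
Qed.

(* The roots of [X^n - u^n] are equidistributed on the circle of radius [|u|];
   averaging over them replaces the mean value property of harmonic functions. *)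
Lemma log_potential_discrete_mean (z u : C) (d q m : R) (n : nat) : (0 < n)%N ->
  0 < d -> {ae rho, forall v, d <= cmod (z - v)} ->
  0 <= q -> cmod u <= q * d -> (forall w, m <= log_potential w) ->
  log_potential (z + u) + n.-1%:R * m <= n%:R * log_potential z + q ^+ n.
Proof.
move=> n0 d0 zd q0 uq mP.
have [rs [srs urs rsu rsE]] := power_difference_roots u n0.
have rsi r : rho.-integrable setT (EFin \o (fun v : C => ln (cmod (z + r - v)))).
  exact: log_potential_integrable.
have [si sE] := Rintegral_sum_seq (P := rho) (s := rs)
  (F := fun r v => ln (cmod (z + r - v))) (fun r _ => rsi r).
apply: (@le_trans _ _ (\sum_(r <- rs) log_potential (z + r))).
  (* The root [u] is kept; each of the other [n.-1] roots contributes at least [m]. *)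
  rewrite (big_rem u urs)/= lerD2l.
  apply: (@le_trans _ _ (\sum_(r <- rem u rs) m)); last exact: ler_sum.
  by rewrite big_const_seq count_predT size_rem// srs iter_addr_0 mulr_natl.
rewrite [leLHS](_ : _ = \int[rho]_v \sum_(r <- rs) ln (cmod (z + r - v))); last first.
  by rewrite sE.
have zi := log_potential_integrable z.
have nzi := integrableZl measurableT n%:R zi.
rewrite -(RintegralZl n%:R measurableT zi).
rewrite -{1}(prob_Rintegral_cst rho (q ^+ n)) -RintegralD//; last exact: integrable_cst.
apply: ae_le_Rintegral => //.
  exact: (integrableD measurableT nzi (integrable_cst rho (q ^+ n))).
have rsne : {ae rho, forall v, forall r, r \in rs -> z + r != v}.
  have : forall s : seq C, {ae rho, forall v, forall r, r \in s -> z + r != v}.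
    elim=> [|r s IH]; first by apply: aeW.
    apply: filterS2 (ae_neq (z + r)) IH => v zr sv t.
    by rewrite inE => /orP[/eqP ->//|]; exact: sv.
  exact.
apply: filterS2 zd rsne => v zv rv.
have d1 : 0 < cmod (z - v) by exact: lt_le_trans zv.
have rv0 r : r \in rs -> 0 < cmod (z + r - v).
  by move=> rrs; rewrite cmod_gt0 subr_eq0 rv.
rewrite -ln_prod_seq//.
have -> : \prod_(r <- rs) cmod (z + r - v) = cmod ((v - z) ^+ n - u ^+ n).
  rewrite -rsE cmod_prod; apply: eq_bigr => r _.
  by rewrite -normcN; congr (ComplexField.Normc.normc _); rewrite !opprD opprK; ring.
(* Here $|u| \le qd \le q|z-v|$. *)
have le1 : cmod ((v - z) ^+ n - u ^+ n) <= cmod (z - v) ^+ n * (1 + q ^+ n).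
  apply: le_trans (cmod_triangle 0 _ _) _.
  rewrite subr0 sub0r normcN !cmodX (cmodB v) mulrDr mulr1 lerD2l.
  rewrite -exprMn lerXn2r ?nnegrE ?cmod_ge0 ?mulr_ge0 ?cmod_ge0//.
  by rewrite (le_trans uq)// mulrC ler_wpM2r.
have q1 : 0 < 1 + q ^+ n by rewrite ltr_wpDr ?exprn_ge0.
have p0 : 0 < cmod ((v - z) ^+ n - u ^+ n).
  rewrite -rsE cmod_prod big_seq prodr_gt0// => r rrs.
  rewrite cmod_gt0 subr_eq0; apply/negP => /eqP vz.
  by have := rv _ rrs; rewrite -vz addrC subrK eqxx.
apply: (@le_trans _ _ (ln (cmod (z - v) ^+ n * (1 + q ^+ n)))).
  by rewrite ler_ln ?posrE// mulr_gt0// exprn_gt0.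
rewrite lnM ?posrE ?exprn_gt0// lnXn// mulr_natl lerD2l.
by apply: le_ln1Dx; rewrite (lt_le_trans _ (exprn_ge0 _ q0))// ltrN10.
Qed.

(** Suppose that the infimum [m] of the potential is below [c]. From an almost minimal point [x],
    step to a point [x + u] close to [low_set]: the potential there is at least [c - e], yet the
    discrete mean inequality keeps it near [m]. *)
Theorem frostman z : ln (cap K) <= log_potential z.
Proof.
rewrite leNgt; apply/negP => z_lt.
set c := ln (cap K) in z_lt *.
have [m [mP minf mc]] : exists m, [/\ forall v, m <= log_potential v,
    forall h, 0 < h -> exists v, log_potential v < m + h & m < c].
  pose D := range log_potential.
  have Dinf : has_inf D.
    split; first by exists (log_potential z), z.
    by exists (c - ln 3) => _ [v _ <-]; exact: log_potential_weak.
  have mP v : inf D <= log_potential v by apply: ge_inf; [case: Dinf|exists v].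
  exists (inf D); split=> [//|h h0|]; last exact: le_lt_trans z_lt.
  by have [_ [v _ <-] vh] := inf_adherent h0 Dinf; exists v.
clear z_lt.
pose e := (c - m) / 2.
have e0 : 0 < e by rewrite divr_gt0// subr_gt0.
have [eta eta0 near] := log_potential_near_uniform e0.
(* [l] is fixed before [x], hence before the distance [d] from [x] to [low_set]; the bound
   [d < cap K] below will give [2 * l * d < eta]. *)
pose l := Num.min (1 / 2) (eta / (2 * cap K)).
have l0 : 0 < l by rewrite lt_min !divr_gt0// mulr_gt0.
have l1 : l <= 1 / 2 by rewrite ge_min lexx.
have leta : 2 * l * cap K <= eta.
  rewrite mulrAC -ler_pdivlMl ?mulr_gt0// mulrC.
  by rewrite ge_min lexx orbT.
pose q := 1 - l.
have q0 : 0 <= q by rewrite /q; lra.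
have q1 : q < 1 by rewrite /q; lra.
have e4 : 0 < e / 4 by rewrite divr_gt0.
have [n n0 qn] := expr_small q0 q1 e4.
have nR : 0 < n%:R :> R by rewrite ltr0n.
(* The mean inequality multiplies the excess over [m] by [n]. *)
have h0 : 0 < e / 4 / n%:R by rewrite divr_gt0.
have [x xm] := minf _ h0.
have xc : log_potential x < c.
  apply: (lt_trans xm).
  have : e / 4 / n%:R <= e / 4 by rewrite ler_pdivrMr// ler_peMr ?(ltW e4)// ler1n.
  have : c = m + 2 * e by rewrite /e; field.
  lra.
have xF : ~ low_set x.
  by move=> /low_set_potential [_]; rewrite leNgt xc.
have [d d0 [xd /(_ (1 + l))]] := low_set_near xF.
rewrite ltrDl => /(_ l0) [v vF xv].
have xdae : {ae rho, forall u, d <= cmod (x - u)}.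
  by apply: filterS low_set_ae => u; exact: xd.
(* The potential at [x] is at least [ln d], and it is less than [ln (cap K)]. *)
have dc : d < cap K.
  rewrite -ltr_ln ?posrE//; apply: le_lt_trans xc.
  rewrite -{1}(prob_Rintegral_cst rho (ln d)); apply: ae_le_Rintegral.
  - exact: integrable_cst.
  - exact: log_potential_integrable.
  by apply: filterS xdae => u du; rewrite ler_ln ?posrE//; exact: lt_le_trans du.
have [u [ud xuv uw]] := approach_point d0 l0 l1 xd xv.
have : c <= log_potential (x + u) + e.
  apply: (near _ v vF uw); apply: (le_lt_trans xuv); apply: lt_le_trans leta.
  by rewrite ltr_pM2l// mulr_gt0.
(* This bounds the potential at [x + u] by [m + e / 4 + e / 4], whereas [c - e = m + e]. *)
have := log_potential_discrete_mean n0 d0 xdae q0 ud mP.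
have nE : n.-1%:R = n%:R - 1 :> R by rewrite -subn1 natrB.
rewrite nE mulrBl mul1r.
have : n%:R * log_potential x < n%:R * m + e / 4.
  by rewrite -ltrBlDl -mulrBr mulrC -ltr_pdivlMr// ltrBlDl.
have : c = m + 2 * e by rewrite /e; field.
move: (log_potential (x + u)) (log_potential x) (n%:R * m) qn => y1 y2 y3; move: (_ ^+ _) (n%:R * _) => *; lra.
Qed.

End MaximumPrinciple.

Lemma log_potential_ge z : ln (cap K) <= log_potential z.
Proof. by have [b b0 Kb] := compact_diameter; exact: frostman b0 Kb z. Qed.

Lemma ln_dist_integrable z :
  rho.-integrable setT (EFin \o (fun u : C => ln (cmod (z - u)))).
Proof. by have [b b0 Kb] := compact_diameter; have [] := all_log_regular b0 Kb z. Qed.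

Lemma equilibrium_no_atom z : {ae rho, forall u, z != u}.
Proof. by have [b b0 Kb] := compact_diameter; have [] := all_log_regular b0 Kb z. Qed.

Lemma log_potential_min_exists : exists2 z, K z & log_potential z = ln (cap K).
Proof.
have [b b0 Kb] := compact_diameter.
have [|z [Kz zE]] := @ae_exists _ _ _ rho
    (fun z => K z /\ (\int[rho]_u log_kernel b (z, u))%E = (ln b - ln (cap K))%:E).
  by apply: filterS2 ae_mem_compact (equilibrium_log_kernel_ae b0 Kb) => z Kz zE; split.
exists z => //; have zb : {ae rho, forall u, cmod (z - u) <= b}.
  by apply: filterS ae_mem_compact => u; exact: Kb.
have [|_] := @log_regular_kernel b z (ln b - ln (cap K)) b0 zb; first by rewrite zE.
by rewrite zE => -[/addrI/oppr_inj].
Qed.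

(** Minimum principle: with [ln (cap K)] the global minimum, attained at [z], the discrete mean
    inequality bounds the excess at [z + u] by [q ^+ n] for every positive [n], where
    [q = cmod u / d < 1]. *)
Lemma log_potential_min_ball z (d : R) u : 0 < d ->
  {ae rho, forall v, d <= cmod (z - v)} -> log_potential z = ln (cap K) ->
  cmod u < d -> log_potential (z + u) = ln (cap K).
Proof.
move=> d0 zd zc ud; have [b b0 Kb] := compact_diameter.
apply/eqP; rewrite eq_le log_potential_ge andbT; apply/ler_addgt0Pr => e e0.
pose q := cmod u / d.
have q0 : 0 <= q by rewrite divr_ge0 ?cmod_ge0// ltW.
have q1 : q < 1 by rewrite ltr_pdivrMr// mul1r.
have [n n0 qn] := expr_small q0 q1 e0.
have uq : cmod u <= q * d by rewrite divfK// gt_eqF.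
have := log_potential_discrete_mean b0 Kb n0 d0 zd q0 uq log_potential_ge.
rewrite zc -subn1 natrB// mulrBl mul1r.
move: (log_potential _) (ln _) (_ * _) qn => x y w; move: (_ ^+ _) => *; lra.
Qed.

(** [lne] and [ln] disagree only at distance 0, that is on the [rho]-null set of the single point
    [z]. *)
Lemma greenE z : green K rho z = (log_potential z - ln (cap K))%:E.
Proof.
rewrite /green addrC EFinD; congr (_ + _)%E.
rewrite -integrable_Rintegral; last exact: ln_dist_integrable.
apply: ae_eq_integral => //.
- by apply: measurable_lne_fun => //; apply: measurable_dist => //; exact: measurable_cst.
- exact: measurable_int (ln_dist_integrable z).
apply: filterS (equilibrium_no_atom z) => u zu _ /=.
by rewrite lne_EFin// cmod_gt0 subr_eq0.
Qed.

End Frostman.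

(** * The outer domain, and weighted norms of polynomials *)

Section WeightedPolynomials.
Set Implicit Arguments.
Unset Strict Implicit.
Context {R : realType}.
Local Notation C := R[i].
Local Arguments lne : simpl never.
Variables (K : set C) (rho : probability C R).
Hypotheses (cK : compact K) (capK : 0 < cap K) (rhoE : is_equilibrium_measure K rho).

Let mK := compact_complex_measurable cK.

Let Kae : {ae rho, forall z, K z} := ae_mem_compact cK rhoE.

Lemma equilibrium_nonempty : K !=set0.
Proof. by have [z Kz] := ae_exists Kae; exists z. Qed.

Lemma poly_bounded_on (P : {poly C}) :
  exists2 B : R, 0 < B & forall z, K z -> cmod P.[z] <= B.
Proof.
have [b b0 Kb] := complex_compact_bounded cK.
elim/poly_ind: P => [|P c [B B0 PB]].
  by exists 1 => // z _; rewrite horner0 ComplexField.Normc.normc0.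
exists (B * b + cmod c); first by rewrite ltr_pwDl ?mulr_gt0 ?cmod_ge0.
move=> z Kz; rewrite !hornerE.
have := cmod_triangle 0 (P.[z] * z) (- c); rewrite opprK subr0 add0r cmodM => h.
by apply: (le_trans h); rewrite lerD2r ler_pM ?cmod_ge0// ?PB// Kb.
Qed.

(** Finite sets are null, since [rho] has no atoms. *)
Lemma root_cofinite_ae (P : {poly C}) : P != 0 -> {ae rho, forall z, P.[z] != 0}.
Proof.
have [rs ->] := closed_field_poly_normal P => P0.
have lc0 : lead_coef P != 0 by move: P0; apply: contraNN => /eqP ->; rewrite scale0r.
elim: rs {P0} => [|r rs IH].
  by apply: aeW => z; rewrite big_nil !hornerE.
apply: filterS2 (equilibrium_no_atom cK capK rhoE r) IH => z rz.
rewrite big_cons !hornerE => Pz.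
by rewrite /= -mulrA mulrCA mulf_neq0// subr_eq0 eq_sym.
Qed.

Lemma off_compact_dist z : ~ K z -> exists2 d : R, 0 < d &
  forall u, K u -> d <= cmod (z - u).
Proof.
move=> Kz; have [|d d0 [zd _]] := @positive_distance _ K z equilibrium_nonempty.
- move=> zK; apply: Kz; apply: (compact_closed (@complex_hausdorff R) cK) => A.
  move=> /nbhs_cmodP[e e0 eA].
  by have [u Ku zu] := zK _ e0; exists u; split=> //; exact: eA.
- by exists d.
Qed.

Lemma off_compact_nbhs z (d : R) u : (forall v, K v -> d <= cmod (z - v)) ->
  cmod (z - u) < d -> ~ K u.
Proof. by move=> zd zu /zd; rewrite leNgt zu. Qed.

Lemma log_potential_lsc z (d : R) u : 0 < d -> (forall v, K v -> d <= cmod (z - v)) ->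
  cmod (z - u) < d -> log_potential rho z <=
    log_potential rho u + cmod (z - u) / (d - cmod (z - u)).
Proof.
move=> d0 zd ud; set t := cmod (z - u).
have iz := ln_dist_integrable cK capK rhoE z.
have iu := ln_dist_integrable cK capK rhoE u.
rewrite -{1}(prob_Rintegral_cst rho (t / (d - t))) -RintegralD//; last exact: integrable_cst.
apply: ae_le_Rintegral => //; first exact: (integrableD measurableT iu (integrable_cst rho _)).
apply: filterS2 Kae (equilibrium_no_atom cK capK rhoE u) => v Kv uv.
have zv := zd _ Kv.
apply: log_le_add => //.
- by rewrite cmod_gt0 subr_eq0.
- exact: lt_le_trans zv.
- exact: cmod_ge0.
- by rewrite [leRHS]addrC; exact: cmod_triangle.
Qed.

Lemma log_potential_far z (b : R) : (forall u, K u -> cmod u <= b) ->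
  cap K + b < cmod z -> ln (cap K) < log_potential rho z.
Proof.
move=> Kb zb; have c0 : 0 < cmod z - b by move: capK; move: (cap K) (cmod z) zb => *; lra.
apply: (@lt_le_trans _ _ (ln (cmod z - b))).
  by rewrite ltr_ln ?posrE// ltrBrDr.
rewrite -{1}(prob_Rintegral_cst rho (ln (cmod z - b))).
apply: ae_le_Rintegral.
- exact: integrable_cst.
- exact: ln_dist_integrable cK capK rhoE z.
apply: filterS Kae => u Ku.
have zu : cmod z - b <= cmod (z - u).
  have := Kb _ Ku; have := cmod_triangle u z 0; rewrite !subr0.
  by move: (cmod _) (cmod _) (cmod _) => *; lra.
by rewrite ler_ln ?posrE//; exact: lt_le_trans zu.
Qed.

(** Connectedness of the component [D] of infinity: [U] (potential above the minimum, or infinity)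
    and [V] (potential equal to it) are open, disjoint and cover [D], and [U] contains infinity. *)
Lemma outer_domain_potential z : outer_domain K (Some z) ->
  ln (cap K) < log_potential rho z.
Proof.
move=> [D [DN DK Dc] Dz].
have potge := log_potential_ge cK capK rhoE.
pose U0 := [set u | ~ K u /\ ln (cap K) < log_potential rho u].
pose V0 := [set u | ~ K u /\ log_potential rho u = ln (cap K)].
pose U : set (one_point_compactification C) := Some @` U0 `|` [set None].
pose V : set (one_point_compactification C) := Some @` V0.
have oV : open V.
  apply: one_point_compactification_open_some; rewrite openE => u [Ku uc].
  (* [V] is open by the minimum principle on a disc free of [K]. *)
  have [d d0 ud] := off_compact_dist Ku.
  apply/nbhs_cmodP; exists d => // v uv; split; first exact: off_compact_nbhs ud uv.
  rewrite -(subrKC u v); apply: log_potential_min_ball d0 _ uc _ => //.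
    by apply: filterS Kae => t; exact: ud.
  by rewrite -normcN opprB.
have oU : open U.
  rewrite openE => -[u [[v [Kv vc] [<-]]|//]|_].
    have [d d0 vd] := off_compact_dist Kv.
    suff : nbhs v U0 by move=> /one_point_compactification_some_nbhs; apply: filterS => _ [t tU <-]; left; exists t.
    have [e eE] : exists e, e = log_potential rho v - ln (cap K) by eexists.
    have e0 : 0 < e by rewrite eE subr_gt0.
    (* This radius makes the error term of [log_potential_lsc] smaller than [e]. *)
    apply/nbhs_cmodP; exists (e * d / (2 + e)); first by rewrite divr_gt0 ?mulr_gt0 ?addr_gt0//.
    move=> t; rewrite ltr_pdivlMr ?addr_gt0// => vt.
    have ct := cmod_ge0 (v - t).
    have td : cmod (v - t) < d.
      by move: vt ct; move: (cmod _) => x h x0; rewrite -(ltr_pM2r e0); nra.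
    split; first exact: off_compact_nbhs vd td.
    have := log_potential_lsc d0 vd td.
    suff : cmod (v - t) / (d - cmod (v - t)) < e by rewrite eE; move: (_ / _) => x *; lra.
    move: vt ct td; move: (cmod _) => x h x0 xd.
    by rewrite ltr_pdivrMr ?subr_gt0// ?subr_gt0//; nra.
  (* At infinity: outside a large square the points are off [K] and the potential exceeds the
     minimum. *)
  have [b b0 Kb] := complex_compact_bounded cK.
  pose B := cap K + b.
  have B0 : 0 <= B by rewrite addr_ge0// ltW.
  pose S := [set t : C | `|complex.Re t| <= B /\ `|complex.Im t| <= B].
  have cS : compact S := complex_square_compact (B := B).
  have S_far t : ~ S t -> B < cmod t.
    move=> St; rewrite ltNge; apply/negP => tB; apply: St; split; apply: le_trans tB.
      exact: Re_le_cmod.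
    exact: Im_le_cmod.
  exists S; first by split=> //; exact: (compact_closed (@complex_hausdorff R)).
  move=> _ [[t St <-]|->]; last by right.
  left; exists t => //; split; last exact: log_potential_far Kb (S_far _ St).
  move=> /Kb; rewrite leNgt => /negP; apply; apply: le_lt_trans (S_far _ St).
  by rewrite lerDr ltW.
have DUV : D `&` U = D `&` ~` V.
  apply/seteqP; split=> [[u|] [Du Uu]|[u|] [Du nV]]; split=> //.
  - case: Uu => [[v [Kv vc] [vu]]|//] [t [Kt tc] [tu]].
    by move: vc; rewrite vu -tu tc ltxx.
  - by case.
  - left; exists u => //.
    have Ku : ~ K u by move=> Ku; apply: (DK _ Du); exists u.
    split=> //; rewrite lt_neqAle potge andbT; apply/eqP => cu; apply: nV.
    by exists u.
  - by right.
have DU : D `&` U = D.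
  apply: Dc; first by exists None; split=> //; right.
    by exists U.
  by exists (~` V) => //; exact: open_closedC.
have [_ [[v [_ vc] [vz]]|//]] : (D `&` U) (Some z) by rewrite DU.
by rewrite -vz.
Qed.

(** * The lower bound, its equality case and the extremal polynomial for a fixed weight *)

Section Weight.
Variable w : C -> R.
Hypothesis hw : szego_class K rho w.

(** [lne 0 = -oo], while an integrable function is finite almost everywhere. *)
Lemma szego_pos_ae : {ae rho, forall z, K z /\ 0 < w z}.
Proof.
have [w0 _ _ wi] := hw.
apply: filterS2 Kae (integrable_ae mK wi) => z Kz /(_ Kz).
by rewrite lneE; case: ifP => // /negbT; rewrite -ltNge.
Qed.

Lemma szego_integral_log : exists v : C -> R,
  [/\ rho.-integrable setT (EFin \o v), {ae rho, forall z, v z = ln (w z)} &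
      szego_integral K rho w = expR (\int[rho]_z v z)].
Proof.
have [w0 _ mw wi] := hw.
pose v := (fun z => ln ((w \_ K) z)).
have mv : measurable_fun setT v.
  exact: (measurableT_comp (@measurable_ln R) ((measurable_restrictT w mK).1 mw)).
have vE : {ae rho, forall z, v z = ln (w z)}.
  by apply: filterS Kae => z Kz; rewrite /v /patch mem_set.
have wi' := (integrable_mkcond _ mK).1 wi.
have vae : {ae rho, forall z, ((fun z => lne (w z)%:E) \_ K) z = (v z)%:E}.
  apply: filterS2 szego_pos_ae vE => z [Kz wz] ->.
  by rewrite /patch mem_set// lne_EFin.
have mvE : measurable_fun setT (EFin \o v) by exact/measurable_EFinP.
have vi : rho.-integrable setT (EFin \o v).
  apply/integrableP; split=> //.
  rewrite (@ae_eq_integral _ _ _ rho setT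
    (fun z => `|((fun z => lne (w z)%:E) \_ K) z|%E))//.
  - by case/integrableP: wi'.
  - by apply: measurableT_comp.
  - by apply: measurableT_comp => //; exact: measurable_int wi'.
  - by apply: filterS vae => z zE _; rewrite /= zE.
exists v; split=> //; rewrite /szego_integral integral_mkcond.
rewrite (@ae_eq_integral _ _ _ rho setT (EFin \o v))//.
- by rewrite integrable_Rintegral.
- exact: measurable_int wi'.
- by apply: filterS vae => z zE _.
Qed.

Let values (P : {poly C}) := [set w z * cmod P.[z] | z in K].

Lemma values_has_sup P : has_sup (values P).
Proof.
have [z0 Kz0] := equilibrium_nonempty; have [w0 [W wW] _ _] := hw.
have [B B0 PB] := poly_bounded_on P.
split; first by exists (w z0 * cmod P.[z0]), z0.
exists (W * B) => _ [z Kz <-]; rewrite ler_pM ?cmod_ge0//; [exact: w0|exact: wW|exact: PB].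
Qed.

Lemma le_wnorm P z : K z -> w z * cmod P.[z] <= wnorm K w P.
Proof. by move=> Kz; apply: sup_upper_bound; [exact: values_has_sup|exists z]. Qed.

Lemma wnorm_le P (B : R) : (forall z, K z -> w z * cmod P.[z] <= B) -> wnorm K w P <= B.
Proof.
move=> PB; apply: ge_sup; first by case: (values_has_sup P).
by move=> _ [z Kz <-]; exact: PB.
Qed.

Lemma wnorm_gt0 P : P != 0 -> 0 < wnorm K w P.
Proof.
move=> P0; have [|z [[Kz wz] Pz]] := @ae_exists _ _ _ rho
  (fun z => (K z /\ 0 < w z) /\ P.[z] != 0).
  by apply: filterS2 szego_pos_ae (root_cofinite_ae P0) => z; split.
by apply: lt_le_trans (le_wnorm P Kz); rewrite mulr_gt0// cmod_gt0.
Qed.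

(** Integrating [ln (cmod (r - z))] in [z] turns each root [r] into a value of the potential. The
    formula for [D] may fail on the null set where [w] or [P] vanishes, because [ln 0 = 0]. *)
Lemma wnorm_defect n P (rs : seq C) : monic_of_degree n P -> size rs = n ->
  P = \prod_(r <- rs) ('X - r%:P) ->
  exists D : C -> R, [/\ rho.-integrable setT (EFin \o D),
    {ae rho, forall z, [/\ K z, 0 < w z * cmod P.[z] &
                          D z = ln (wnorm K w P) - ln (w z * cmod P.[z])]} &
    ln (wnorm K w P) - ln (szego_integral K rho w * cap K ^+ n) =
    \int[rho]_z D z + \sum_(r <- rs) (log_potential rho r - ln (cap K))].
Proof.
move=> Pn rsn PE; have P0 := monic_of_degree_neq0 Pn.
have [v [vi vE SE]] := szego_integral_log.
have ri r : rho.-integrable setT (EFin \o (fun z : C => ln (cmod (r - z)))).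
  exact: ln_dist_integrable cK capK rhoE r.
have [si sE] := Rintegral_sum_seq (P := rho) (s := rs)
  (F := fun r z => ln (cmod (r - z))) (fun r _ => ri r).
pose A := ln (wnorm K w P).
pose g z := v z + \sum_(r <- rs) ln (cmod (r - z)).
have gi : rho.-integrable setT (EFin \o g) by exact: (integrableD measurableT vi si).
exists (fun z => A - g z); split.
- exact: (integrableB measurableT (integrable_cst rho A) gi).
- apply: filterS3 szego_pos_ae vE (root_cofinite_ae P0) => z [Kz wz] vz Pz.
  have Pz0 : 0 < cmod P.[z] by rewrite cmod_gt0.
  split=> //; first by rewrite mulr_gt0.
  congr (_ - _); rewrite lnM ?posrE// /g vz; congr (_ + _).
  have PzE : P.[z] = \prod_(r <- rs) (z - r).
    by rewrite PE horner_prod; apply: eq_bigr => r _; rewrite !hornerE.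
  rewrite PzE cmod_prod ln_prod_seq.
    by apply: eq_bigr => r _; rewrite cmodB.
  move=> r rrs; rewrite cmod_gt0; apply: contraNN Pz => /eqP zr.
  by rewrite PzE (big_rem r rrs)/= zr mul0r.
- rewrite RintegralB//; last exact: integrable_cst.
  rewrite prob_Rintegral_cst RintegralD// sE SE.
  rewrite lnM ?posrE ?expR_gt0 ?exprn_gt0// expRK lnXn// big_split/=.
  rewrite -/(log_potential rho) sumrN big_const_seq count_predT rsn iter_addr_0.
  rewrite -[\sum_(r <- rs) log_potential rho r]/(\sum_(r <- rs) (\int[rho]_z ln (cmod (r - z)))).
  rewrite -/A; lra.
Qed.

Lemma defect_ge0_ae P (D : C -> R) :
  {ae rho, forall z, [/\ K z, 0 < w z * cmod P.[z] &
                          D z = ln (wnorm K w P) - ln (w z * cmod P.[z])]} ->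
  {ae rho, forall z, 0 <= D z}.
Proof.
apply: filterS => z [Kz wP0 ->]; rewrite subr_ge0 ler_ln ?posrE//; first exact: le_wnorm.
exact: lt_le_trans (le_wnorm P Kz).
Qed.

Lemma szego_integral_gt0 : 0 < szego_integral K rho w.
Proof. by have [v [_ _ ->]] := szego_integral_log; exact: expR_gt0. Qed.

Lemma wnorm_ge n P : monic_of_degree n P ->
  szego_integral K rho w * cap K ^+ n <= wnorm K w P.
Proof.
move=> Pn; have [rs rsn PE] := monic_of_degree_roots Pn.
have [D [Di DE defect]] := wnorm_defect Pn rsn PE.
rewrite -ler_ln ?posrE ?wnorm_gt0 ?(monic_of_degree_neq0 Pn)//; last first.
  by rewrite mulr_gt0 ?szego_integral_gt0// exprn_gt0.
rewrite -subr_ge0 defect addr_ge0//; first exact: ae_Rintegral_ge0 (defect_ge0_ae DE).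
by apply: sumr_ge0 => r _; rewrite subr_ge0; exact: log_potential_ge cK capK rhoE r.
Qed.

(** Equality means that the integral and the sum in [wnorm_defect], both nonnegative, vanish; then
    so does each summand, and [D] almost everywhere. *)
Lemma wnorm_eqP n P : monic_of_degree n P ->
  wnorm K w P = szego_integral K rho w * cap K ^+ n <->
  (forall z, root P z -> green K rho z = 0%E) /\
  {ae rho, forall z, K z -> w z * cmod P.[z] = wnorm K w P}.
Proof.
move=> Pn; have [rs rsn PE] := monic_of_degree_roots Pn.
have [D [Di DE defect]] := wnorm_defect Pn rsn PE.
have D0 := defect_ge0_ae DE.
have N0 : 0 < wnorm K w P by rewrite wnorm_gt0 ?(monic_of_degree_neq0 Pn).
have S0 : 0 < szego_integral K rho w * cap K ^+ n.
  by rewrite mulr_gt0 ?szego_integral_gt0// exprn_gt0.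
have rootE z : root P z = (z \in rs) by rewrite PE root_prod_XsubC.
have g0 r : 0 <= log_potential rho r - ln (cap K).
  by rewrite subr_ge0; exact: log_potential_ge cK capK rhoE r.
have ID0 := ae_Rintegral_ge0 Di D0.
have G0 : 0 <= \sum_(r <- rs) (log_potential rho r - ln (cap K)).
  by apply: sumr_ge0 => r _; exact: g0.
split=> [NS|[rg NE]].
  rewrite NS subrr in defect.
  have [I0 sum0] : \int[rho]_z D z = 0 /\
      \sum_(r <- rs) (log_potential rho r - ln (cap K)) = 0.
    by move: defect ID0 G0; move: (\int[rho]_z D z) (\sum_(r <- rs) _) => x y; lra.
  split=> [z|].
    rewrite rootE => zrs; rewrite (greenE cK capK rhoE); congr EFin.
    by move/eqP: sum0; rewrite psumr_eq0// => /allP /(_ _ zrs) /eqP.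
  apply: filterS2 DE (ae_eq_Rintegral_ge0 Di D0 I0) => z [Kz wPz ->] /eqP.
  by rewrite subr_eq0 => /eqP /(@ln_inj _) -> //; rewrite posrE.
apply: (@ln_inj R); rewrite ?posrE//; apply/eqP; rewrite -subr_eq0 defect.
rewrite big1_seq; last first.
  move=> r /= rrs; have := rg r; rewrite rootE => /(_ rrs).
  by rewrite (greenE cK capK rhoE) => -[].
rewrite addr0; apply/eqP.
rewrite /Rintegral (@ae_eq_integral _ _ _ rho setT (cst 0%E)) ?integral0//.
- exact: measurable_int Di.
- by apply: filterS2 DE NE => z [Kz wPz Dz] /(_ Kz) NE _; rewrite /= Dz NE subrr.
Qed.

(** The midpoint of two extremal polynomials is extremal too, so all three have the same modulus
    almost everywhere. By strict convexity [P = Q] almost everywhere, which exceeds what the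
    finitely many roots of a nonzero [P - Q] allow. *)
Lemma wnorm_eq_unique n P Q : monic_of_degree n P -> monic_of_degree n Q ->
  wnorm K w P = szego_integral K rho w * cap K ^+ n ->
  wnorm K w Q = szego_integral K rho w * cap K ^+ n -> P = Q.
Proof.
move=> Pn Qn PN QN; have Hn := monic_midpoint Pn Qn.
set H := P + _ in Hn; set N := szego_integral K rho w * cap K ^+ n in PN QN.
have hE : 2^-1 = ((2^-1 : R)%:C)%C by rewrite fmorphV rmorph_nat.
have HN : wnorm K w H = N.
  apply/eqP; rewrite eq_le wnorm_ge// andbT; apply: wnorm_le => z Kz.
  have [w0 _ _ _] := hw.
  have : w z * cmod H.[z] <= 2^-1 * (w z * cmod P.[z]) + 2^-1 * (w z * cmod Q.[z]).
    rewrite !(mulrCA 2^-1) -mulrDr ler_wpM2l ?w0//.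
    have -> : H.[z] = 2^-1 * P.[z] - (- (2^-1 * Q.[z])).
      by rewrite /H !hornerE; field.
    apply: le_trans (cmod_triangle 0 _ _) _.
    by rewrite subr0 sub0r opprK !cmodM hE cmod_real// invr_ge0.
  have := le_wnorm P Kz; have := le_wnorm Q Kz; rewrite PN QN.
  move: (w z * _) (w z * _) (w z * _) => x y t *; lra.
have [_ Pae] := (wnorm_eqP Pn).1 PN; have [_ Qae] := (wnorm_eqP Qn).1 QN.
have [_ Hae] := (wnorm_eqP Hn).1 HN.
apply/eqP; rewrite -subr_eq0; apply: contrapT => /negP PQ.
have PQae : {ae rho, forall z, P.[z] = Q.[z]}.
  have PQNae : {ae rho, forall z, (K z -> w z * cmod P.[z] = wnorm K w P) /\
      (K z -> w z * cmod Q.[z] = wnorm K w Q)}.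
    by apply: filterS2 Pae Qae => z; split.
  apply: filterS3 szego_pos_ae PQNae Hae => z [Kz wz] [/(_ Kz) Pz /(_ Kz) Qz] /(_ Kz) Hz.
  apply: (@cmod_midpoint_eq _ _ _ (N / w z)).
  - by rewrite -PN -Pz mulrC mulKf// gt_eqF.
  - by rewrite -QN -Qz mulrC mulKf// gt_eqF.
  - have -> : P.[z] + 2^-1 * (Q.[z] - P.[z]) = H.[z] by rewrite /H !hornerE.
    by rewrite -HN -Hz mulrC mulKf// gt_eqF.
have [|z [PQz]] := @ae_exists _ _ _ rho (fun z => P.[z] = Q.[z] /\ (P - Q).[z] != 0).
  by apply: filterS2 PQae (root_cofinite_ae PQ) => z; split.
by rewrite !hornerE PQz subrr eqxx.
Qed.

(** The set has full measure and [rho] has no atoms. The sequence provides interpolation nodes. *)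
Lemma weight_support_infinite : exists x : nat -> C,
  injective x /\ forall i, K (x i) /\ 0 < w (x i).
Proof.
pose A := [set z | K z /\ 0 < w z].
have : infinite_set A.
  move=> /finite_seqP [s As].
  have sae : {ae rho, forall z, z \notin s}.
    have : forall t : seq C, {ae rho, forall z, z \notin t}.
      elim=> [|a t IH]; first by apply: aeW.
      apply: filterS2 (equilibrium_no_atom cK capK rhoE a) IH => z az tz.
      by rewrite inE negb_or eq_sym az.
    exact.
  have [|z [Az]] := @ae_exists _ _ _ rho (fun z => A z /\ z \notin s).
    by apply: filterS2 szego_pos_ae sae => z; split.
  by move: Az; rewrite As /= => ->.
move=> /infiniteP /pcard_leP [f]; exists f; split.
  by move=> i j fij; apply: (@inj _ _ _ f) => //; rewrite in_setT.
by move=> i; have := @funS _ _ _ _ f i; apply.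
Qed.

Lemma wnorm_le_add (P : {poly C}) (n : nat) (Q : {poly C}) (L : 'I_n -> {poly C}) (c : 'I_n -> C) :
  P = Q + \sum_(i < n) (c i)%:P * L i ->
  wnorm K w P <= wnorm K w Q + \sum_(i < n) cmod (c i) * wnorm K w (L i).
Proof.
move=> ->; apply: wnorm_le => z Kz; have [w0 _ _ _] := hw.
have sum_le : cmod (\sum_(i < n) c i * (L i).[z]) <= \sum_(i < n) cmod (c i) * cmod (L i).[z].
  elim/big_ind2: _ => [|x1 x2 y1 y2 h1 h2|i _]; rewrite ?ComplexField.Normc.normc0 ?cmodM//.
  apply: le_trans (lerD h1 h2).
  exact: le_normcD.
have -> : (Q + \sum_(i < n) (c i)%:P * L i).[z] = Q.[z] - (- (\sum_(i < n) c i * (L i).[z])).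
  rewrite opprK hornerD horner_sum; congr (_ + _).
  by apply: eq_bigr => i _; rewrite hornerM hornerC.
apply: le_trans (ler_wpM2l (w0 _ Kz) (cmod_triangle 0 _ _)) _.
rewrite subr0 sub0r opprK mulrDr lerD ?le_wnorm//.
apply: le_trans (ler_wpM2l (w0 _ Kz) sum_le) _.
rewrite mulr_sumr; apply: ler_sum => i _.
by rewrite mulrCA ler_wpM2l ?cmod_ge0// le_wnorm.
Qed.

Lemma wnorm_ge0 (P : {poly C}) : 0 <= wnorm K w P.
Proof.
have [z Kz] := equilibrium_nonempty; have [w0 _ _ _] := hw.
by apply: le_trans (le_wnorm P Kz); rewrite mulr_ge0 ?cmod_ge0 ?w0.
Qed.

(** A monic polynomial is encoded by the values of its difference with ['X^n] at [n] nodes where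
    [w > 0]. The norm is continuous in these values and, outside a compact box, larger than at the
    origin. *)
Lemma weighted_chebyshev_exists n : (0 < n)%N ->
  exists P, is_weighted_chebyshev K w n P.
Proof.
move=> n0; have [x [x_inj xK]] := weight_support_infinite.
pose L (i : 'I_n) : {poly C} := tnth (n.-lagrange x) i.
pose S (v : 'rV[C]_n) : {poly C} := \sum_(i < n) (v ord0 i)%:P * L i.
pose p v := 'X^n + S v.
have Sx v (j : 'I_n) : (S v).[x j] = v ord0 j.
  rewrite /S horner_sum (bigD1 j)//= big1 => [|i ij].
    by rewrite hornerM hornerC lagrange_sample// eqxx mulr1 addr0.
  by rewrite hornerM hornerC lagrange_sample// (negbTE ij) mulr0.
have p_monic v : monic_of_degree n (p v).
  have sS : (size (S v) < size ('X^n : {poly C}))%N.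
    rewrite size_polyXn ltnS; apply: leq_trans (size_sum _ _ _) _.
    apply/bigmax_leqP => i _; rewrite mul_polyC (leq_trans (size_scale_leq _ _))//.
    by rewrite size_lagrange_.
  split; last by rewrite size_polyDl// size_polyXn.
  by rewrite monicE lead_coefDl// lead_coefXn.
have p_surj Q : monic_of_degree n Q -> exists v, Q = p v.
  move=> [Qm sQ]; exists (\row_i (Q - 'X^n).[x i]).
  have sD : (size (Q - 'X^n)%R <= n)%N.
    apply/leq_sizeP => j; rewrite leq_eqVlt coefB coefXn => /orP[/eqP <-|nj].
      by move/monicP: Qm; rewrite lead_coefE sQ /= => ->; rewrite eqxx subrr.
    by rewrite nth_default ?sQ// gtn_eqF// subrr.
  rewrite /p /S -[LHS](subrK 'X^n) addrC; congr (_ + _).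
  rewrite {1}(lagrange_gen n0 x_inj sD); apply: eq_bigr => i _.
  by rewrite mxE.
pose f v := wnorm K w (p v).
have f_lip u v : f u <= f v + \sum_(i < n) cmod (u ord0 i - v ord0 i) * wnorm K w (L i).
  apply: wnorm_le_add; rewrite /p /S -addrA; congr (_ + _).
  rewrite -big_split; apply: eq_bigr => i _ /=.
  by rewrite -mulrDl -polyCD addrC subrK.
have f_cont : continuous f.
  suff cv (v : 'rV[C]_n) : f @ v --> f v by [].
  apply/(@cvgrPdist_le _ _ _ (nbhs v) (nbhs_filter v)) => e e0.
  pose W := \sum_(i < n) wnorm K w (L i).
  have W0 : 0 <= W by apply: sumr_ge0 => i _; exact: wnorm_ge0.
  have W1 : 0 < W + 1 by rewrite ltr_wpDl.
  have eW : 0 < e / (W + 1) by rewrite divr_gt0.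
  have nearv : nbhs v [set u : 'rV[C]_n | forall i : 'I_n,
      cmod (v ord0 i - u ord0 i) < e / (W + 1)].
    apply: (@filter_forall _ _ (fun i (u : 'rV[C]_n) =>
      cmod (v ord0 i - u ord0 i) < e / (W + 1)) (nbhs v) (nbhs_filter v)) => i.
    have := @coord_continuous C 1 n ord0 i v [set t | cmod (v ord0 i - t) < e / (W + 1)].
    by apply; apply/nbhs_cmodP; exists (e / (W + 1)).
  apply: filterS nearv => u vu.
  have sumle (g : 'I_n -> R) : (forall i, g i < e / (W + 1)) ->
      \sum_(i < n) g i * wnorm K w (L i) <= e.
    move=> ge; apply: (@le_trans _ _ (\sum_(i < n) e / (W + 1) * wnorm K w (L i))).
      by apply: ler_sum => i _; rewrite ler_wpM2r ?wnorm_ge0// ltW.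
    rewrite -mulr_sumr -/W mulrAC ler_pdivrMr// ler_wpM2l ?(ltW e0)//.
    by rewrite lerDl.
  have h1 : f v <= f u + e by apply: le_trans (f_lip v u) _; rewrite lerD2l sumle.
  have h2 : f u <= f v + e.
    apply: le_trans (f_lip u v) _; rewrite lerD2l sumle// => i.
    by rewrite cmodB.
  by rewrite ler_norml; apply/andP; split; lra.
pose N0 := f 0.
(* Outside the box some $|v_i|$ exceeds $N_0/w(x_i)+|x_i|^n$, so that $w|p_v|$ exceeds $N_0$, the
   norm of ['X^n], at the node $x_i$. *)
pose B := \sum_(i < n) (N0 / w (x i) + cmod (x i) ^+ n).
have Bi (i : 'I_n) : N0 / w (x i) + cmod (x i) ^+ n <= B.
  rewrite /B (bigD1 i)//= lerDl; apply: sumr_ge0 => j _.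
  by rewrite addr_ge0 ?exprn_ge0 ?cmod_ge0// divr_ge0 ?wnorm_ge0// ltW// (xK j).2.
have B0 : 0 <= B.
  apply: sumr_ge0 => j _.
  by rewrite addr_ge0 ?exprn_ge0 ?cmod_ge0// divr_ge0 ?wnorm_ge0// ltW// (xK j).2.
pose sq := [set z : C | `|complex.Re z| <= B /\ `|complex.Im z| <= B].
have box_compact : compact [set v : 'rV[C]_n | forall i, sq (v ord0 i)].
  exact: (@rV_compact C n (fun=> sq) (fun=> complex_square_compact (B := B))).
have box0 : [set v : 'rV[C]_n | forall i, sq (v ord0 i)] 0.
  by move=> i; rewrite /sq /= mxE /= normr0.
have [|c cbox cmin] := compact_EVT_min (f := f) (ex_intro _ _ box0) box_compact.
  exact: continuous_subspaceT.
exists (p c); split=> // Q /p_surj [v ->].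
have [vbox|vbox] := pselect (forall i, sq (v ord0 i)).
  by apply: cmin; rewrite inE.
apply: (@le_trans _ _ N0); first by apply: cmin; rewrite inE.
move/existsNP: vbox => [i vi].
have vB : B < cmod (v ord0 i).
  rewrite ltNge; apply/negP => vB; apply: vi; split; apply: le_trans vB.
    exact: Re_le_cmod.
  exact: Im_le_cmod.
have [Kx wx] := xK i.
have pvx : (p v).[x i] = x i ^+ n + v ord0 i by rewrite /p hornerD hornerXn Sx.
apply: le_trans (le_wnorm (p v) Kx).
rewrite mulrC -ler_pdivrMr//.
have := cmod_triangle 0 (x i ^+ n + v ord0 i) (x i ^+ n).
rewrite addrAC subrr add0r subr0 sub0r normcN cmodX -pvx.
have := Bi i; move: vB; move: (N0 / _) (cmod _) (cmod _ ^+ _) (cmod _) => y1 y2 y3 y4; lra.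
Qed.

Lemma extremal_flat_ball n P : (0 < n)%N -> monic_of_degree n P ->
  wnorm K w P = szego_integral K rho w * cap K ^+ n ->
  exists z0, exists2 d : R, 0 < d &
    forall u, cmod u < d -> log_potential rho (z0 + u) = ln (cap K).
Proof.
move=> n0 Pn PN; have [rg Pae] := (wnorm_eqP Pn).1 PN.
have N0 := wnorm_gt0 (monic_of_degree_neq0 Pn).
have [rs rsn PE] := monic_of_degree_roots Pn.
case: rs rsn PE => [|z0 rs] rsn PE; first by move: n0; rewrite -rsn.
have /rg : root P z0 by rewrite PE root_prod_XsubC inE eqxx.
rewrite (greenE cK capK rhoE) => -[/eqP]; rewrite subr_eq0 => /eqP z0c.
have [w0 [W wW] _ _] := hw.
have [B B0 QB] := poly_bounded_on (\prod_(r <- rs) ('X - r%:P)).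
have W1 : 0 < `|W| + 1 by rewrite ltr_wpDl.
(* Almost everywhere [N] is [w] times $|z-z_0|$ times the modulus of the cofactor, where [w] and the
   cofactor are bounded; so $|z-z_0| \ge d$. *)
pose N := wnorm K w P; pose d := N / ((`|W| + 1) * B).
have d0 : 0 < d by rewrite divr_gt0// mulr_gt0.
exists z0, d => // u ud; apply: (log_potential_min_ball cK capK rhoE d0) => //.
apply: filterS2 Pae Kae => z + Kz => /(_ Kz) wP.
rewrite ler_pdivrMr ?mulr_gt0// /N -wP PE big_cons hornerM hornerXsubC cmodM cmodB.
rewrite mulrCA ler_wpM2l ?cmod_ge0// ler_pM ?cmod_ge0 ?w0 ?QB//.
by rewrite (le_trans (wW _ Kz))// (le_trans (ler_norm W))// lerDl.
Qed.

(** Moving vertically away from the real axis increases the distance to every real point, hence the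
    potential. *)
Lemma real_potential_not_flat z0 (d : R) : K `<=` [set z | complex.Im z = 0] -> 0 < d ->
  ~ (forall u, cmod u < d -> log_potential rho (z0 + u) = ln (cap K)).
Proof.
move=> Kr d0 flat.
(* The direction away from the axis. Comparing displacements [d / 3] and [2 * (d / 3)] keeps both
   points off the axis even if [z0] is real. *)
pose sg : R := if 0 <= complex.Im z0 then 1 else -1.
have sgn : `|sg| = 1 by rewrite /sg; case: ifP => _; rewrite ?normrN normr1.
have d3 : 0 < d / 3 by rewrite divr_gt0.
pose u (t : R) : C := (0 +i* (sg * t))%C.
have uE (t : R) : 0 <= t -> cmod (u t) = t.
  move=> t0; rewrite /u /ComplexField.Normc.normc/= expr0n/= add0r sqrtr_sqr normrM.
  by rewrite sgn mul1r ger0_norm.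
have f1 : log_potential rho (z0 + u (d / 3)) = ln (cap K).
  by apply: flat; rewrite uE ?(ltW d3)//; lra.
have f2 : log_potential rho (z0 + u (2 * (d / 3))) = ln (cap K).
  by apply: flat; rewrite uE ?mulr_ge0 ?(ltW d3)//; lra.
pose D z := ln (cmod (z0 + u (2 * (d / 3)) - z)) - ln (cmod (z0 + u (d / 3) - z)).
have i1 := ln_dist_integrable cK capK rhoE (z0 + u (d / 3)).
have i2 := ln_dist_integrable cK capK rhoE (z0 + u (2 * (d / 3))).
have Di : rho.-integrable setT (EFin \o D) by exact: (integrableB measurableT i2 i1).
have D0 : \int[rho]_z D z = 0.
  rewrite RintegralB// -[X in X - _]/(log_potential rho _) -[X in _ - X]/(log_potential rho _).
  by rewrite f1 f2 subrr.
have Dpos : {ae rho, forall z, 0 < D z}.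
  apply: filterS Kae => -[x y] /Kr /= ->; rewrite /D subr_gt0.
  have [h [hpos h1 h2]] : exists h : R, [/\ 0 < h,
      (complex.Im z0 + sg * (d / 3)) ^+ 2 = h ^+ 2 &
      (complex.Im z0 + sg * (2 * (d / 3))) ^+ 2 = (h + d / 3) ^+ 2].
    exists (`|complex.Im z0| + d / 3); split; first by rewrite ltr_wpDl.
      rewrite /sg; case: (leP 0 (complex.Im z0)) => y0.
        by rewrite ger0_norm// mul1r.
      by rewrite ltr0_norm//; ring.
    rewrite /sg; case: (leP 0 (complex.Im z0)) => y0.
      by rewrite ger0_norm//; ring.
    by rewrite ltr0_norm//; ring.
  case: (z0) h1 h2 => a b /=; rewrite !addr0 !subr0 => -> ->.
  have hh : h ^+ 2 < (h + d / 3) ^+ 2.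
    by rewrite ltrXn2r ?nnegrE ?ltrDl// ?addr_ge0 ?(ltW hpos) ?(ltW d3).
  have s0 : 0 < (a - x) ^+ 2 + h ^+ 2 by rewrite ltr_wpDl ?sqr_ge0// exprn_gt0.
  have s1 : 0 < (a - x) ^+ 2 + (h + d / 3) ^+ 2.
    by rewrite ltr_wpDl ?sqr_ge0// exprn_gt0// addr_gt0.
  by rewrite ltr_ln ?posrE ?sqrtr_gt0// ltr_sqrt// ltrD2l.
have Dge0 : {ae rho, forall z, 0 <= D z} by apply: filterS Dpos => z /ltW.
have Deq0 := ae_eq_Rintegral_ge0 Di Dge0 D0.
have [|z [+ Dz]] := @ae_exists _ _ _ rho (fun z => 0 < D z /\ D z = 0).
  by apply: filterS2 Dpos Deq0 => z; split.
by rewrite Dz ltxx.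
Qed.

Lemma wnorm_strict n P : (0 < n)%N -> monic_of_degree n P ->
  K `<=` [set z | complex.Im z = 0] \/ (polynomial_hull K)° = set0 ->
  szego_integral K rho w * cap K ^+ n < wnorm K w P.
Proof.
move=> n0 Pn geo; rewrite lt_neqAle wnorm_ge// andbT; apply/eqP => /esym PN.
have [z0 [d d0 flat]] := extremal_flat_ball n0 Pn PN.
case: geo => [Kr|hull]; first exact: real_potential_not_flat Kr d0 flat.
(* A point of the flat disc cannot lie in the outer domain, where the potential exceeds
   [ln (cap K)]. *)
have : (polynomial_hull K)° z0.
  apply/nbhs_cmodP; exists d => // u zu /outer_domain_potential.
  by rewrite -(subrKC z0 u) flat ?ltxx// cmodB.
by rewrite hull.
Qed.

Lemma weighted_chebyshevP n : (0 < n)%N ->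
  is_weighted_chebyshev K w n (weighted_chebyshev K w n).
Proof. by move=> n0; exact: (xgetPex 0 (weighted_chebyshev_exists n0)). Qed.

Lemma szego_integral_le_widom n : (0 < n)%N ->
  szego_integral K rho w <= widom_factor K w n.
Proof.
move=> n0; have [Tn _] := weighted_chebyshevP n0.
by rewrite /widom_factor ler_pdivlMr ?exprn_gt0//; exact: wnorm_ge.
Qed.

Lemma widom_eqP n : (0 < n)%N -> widom_factor K w n = szego_integral K rho w <->
  wnorm K w (weighted_chebyshev K w n) = szego_integral K rho w * cap K ^+ n.
Proof.
move=> n0; have c0 : cap K ^+ n != 0 by rewrite expf_neq0// gt_eqF.
by rewrite /widom_factor; split=> [<-|->]; rewrite ?divfK// mulfK.
Qed.

End Weight.

(** The weight is continuous and has a positive minimum on the compact [K], so its logarithm is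
    bounded there. *)
Lemma positive_poly_szego (p : {poly C}) : positive_poly_on K p ->
  szego_class K rho (poly_weight p).
Proof.
move=> p0; have pw z : K z -> 0 < poly_weight p z.
  by move=> /p0; rewrite /poly_weight ltcE => /andP[].
have [B B0 pB] := poly_bounded_on p.
have pwB z : K z -> poly_weight p z <= B.
  by move=> Kz; rewrite (le_trans _ (pB _ Kz))// (le_trans (ler_norm _))// Re_le_cmod.
have pc : continuous (poly_weight p) by case: (complex_poly_parts_continuous p).
have mp := continuous_complex_measurable pc.
have [|c cK' cmin] := compact_EVT_min (f := poly_weight p) equilibrium_nonempty cK.
  exact: continuous_subspaceT.
rewrite inE in cK'; have c0 := pw _ cK'.
split.
- by move=> z /pw /ltW.
- by exists B.
- exact: measurable_funTS.
apply/(integrable_mkcond _ mK).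
pose v := (fun z => ln (poly_weight p z)) \_ K.
have mv : measurable_fun setT v.
  apply/(measurable_restrictT _ mK); apply: measurable_funTS.
  exact: (measurableT_comp (@measurable_ln R) mp).
rewrite (_ : _ \_ K = EFin \o v); last first.
  apply/funext => z; rewrite /v /patch /=; case: ifPn => //; rewrite inE => /pw pz.
  by rewrite lne_EFin.
apply: (@ae_between_integrable _ _ _ rho v (cst (ln (poly_weight p c))) (cst (ln B))) => //.
- exact: integrable_cst.
- exact: integrable_cst.
- apply: filterS Kae => z Kz; rewrite /v /patch mem_set//= ler_ln ?posrE ?pw//.
  by apply: cmin; rewrite inE.
- by apply: filterS Kae => z Kz; rewrite /v /patch mem_set//= ler_ln ?posrE ?pw ?pwB.
Qed.

End WeightedPolynomials.

(** * Polynomial weights on a real set *)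

Section Sharpness.
Set Implicit Arguments.
Unset Strict Implicit.
Context {R : realType}.
Local Notation C := R[i].
Variables (K : set C) (rho : probability C R).
Hypotheses (cK : compact K) (capK : 0 < cap K) (rhoE : is_equilibrium_measure K rho).

Let Kae : {ae rho, forall z, K z} := ae_mem_compact cK rhoE.

Lemma polynomial_weight_sharp n (e : R) : K `<=` [set z | complex.Im z = 0] ->
  (0 < n)%N -> 0 < e -> exists2 p : {poly C}, positive_poly_on K p &
  widom_factor K (poly_weight p) n / szego_integral K rho (poly_weight p) <= 1 + e.
Proof.
move=> Kr n0 e0.
(* A zero of the Green function, so that [(X - x0)^n] contributes nothing to the sum over roots. *)
have [x0 Kx0 x0c] := log_potential_min_exists cK capK rhoE.
have [b b0 Kb] := compact_diameter cK.
pose t (z : C) := cmod (x0 - z) / b.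
have t01 z : K z -> 0 <= t z <= 1.
  move=> Kz; rewrite divr_ge0 ?cmod_ge0 ?(ltW b0)//= ler_pdivrMr// mul1r.
  exact: Kb.
have tpos : {ae rho, forall z, K z /\ 0 < t z}.
  apply: filterS2 Kae (equilibrium_no_atom cK capK rhoE x0) => z Kz xz; split=> //.
  by rewrite divr_gt0// cmod_gt0 subr_eq0.
have lnt : {ae rho, forall z, ln (t z) = ln (cmod (x0 - z)) - ln b}.
  apply: filterS (equilibrium_no_atom cK capK rhoE x0) => z xz.
  by rewrite ln_div ?posrE// cmod_gt0 subr_eq0.
have mt : measurable_fun setT t.
  by apply: measurable_funM => //; apply: measurable_dist => //; exact: measurable_cst.
pose Q m z := invsqrt_iter (2^-1 : R) m (t z ^+ 2).
have mQ m : measurable_fun setT (Q m).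
  rewrite /Q; elim: m => [|m IH] /=; first exact: measurable_cst.
  apply: measurable_funM => //; apply: measurable_funD => //.
  apply: measurable_funM => //; apply: measurable_funB => //.
  by apply: measurable_funM; apply: measurable_funX.
(* The logarithmic error of approximating [1 / t] by [Q m]; it lies between [ln t] and 0 and tends
   to 0 almost everywhere. *)
pose U m z := ln (t z * Q m z).
have mU m : measurable_fun setT (U m).
  by apply: (measurableT_comp (@measurable_ln R)); exact: measurable_funM.
have Ub : {ae rho, forall z, forall m, [/\ 0 < t z * Q m z, ln (t z) <= U m z, U m z <= 0 &
    - U m z <= (1 - t z / 2) ^+ m / t z]}.
  apply: filterS tpos => z [Kz tz] m; have /andP[_ t1] := t01 _ Kz.
  exact: ln_invsqrt_iter_le.
have li : rho.-integrable setT (EFin \o (fun z => ln (t z))).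
  have i0 := ln_dist_integrable cK capK rhoE x0.
  have i1 := integrableB measurableT i0 (integrable_cst rho (ln b)).
  apply: (ae_between_integrable _ i1 i1).
  - exact: (measurableT_comp (@measurable_ln R) mt).
  - by apply: filterS lnt => z ->.
  - by apply: filterS lnt => z ->.
have Ui m : rho.-integrable setT (EFin \o U m).
  apply: (ae_between_integrable (mU m) li (integrable_cst rho 0)).
  - by apply: filterS Ub => z /(_ m) [].
  - by apply: filterS Ub => z /(_ m) [].
have nR : 0 < n%:R :> R by rewrite ltr0n.
(* The threshold for the integral of [U m] demanded by [sharp_bound]. *)
have e1 : 0 < ln (1 + e) / n%:R by rewrite divr_gt0// ln_gt0// ltrDl.
have [||m mlt] := @exists_integral_near0 _ _ _ rho U (fun z => `|ln (t z)|) _ e1 Ui (integrable_norm li).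
- apply: filterS Ub => z zU m; have [_ h1 h2 _] := zU m.
  by rewrite !ler0_norm ?lerN2// (le_trans h1).
- apply: filterS2 tpos Ub => z [Kz tz] zU.
  apply/cvgrPdist_lt => h h0; have /andP[_ t1] := t01 _ Kz.
  have q0 : 0 <= 1 - t z / 2 by lra.
  have q1 : 1 - t z / 2 < 1 by lra.
  have := @cvg_expr R (1 - t z / 2); rewrite ger0_norm// => /(_ q1).
  move=> /cvgrPdist_lt /(_ (h * t z)) /(_ (mulr_gt0 h0 tz)); apply: filterS => m.
  rewrite !sub0r !normrN ger0_norm ?exprn_ge0// => mh.
  have [_ _ h2 h3] := zU m; rewrite ler0_norm//.
  by apply: (le_lt_trans h3); rewrite ltr_pdivrMr.
pose Y : {poly C} := ((b^-1)%:C)%C%:P * ('X - x0%:P).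
pose qm : {poly C} := invsqrt_iter ((2^-1 : R)%:C)%C%:P m (Y ^+ 2).
(* On a real set $|x_0-z|^2=(z-x_0)^2$ is a polynomial in $z$; this is why the iteration is run on
   [t ^+ 2]. *)
have qE z : K z -> qm.[z] = ((Q m z)%:C)%C.
  move=> Kz; have -> : qm.[z] = invsqrt_iter ((2^-1 : R)%:C)%C m (Y.[z] ^+ 2).
    by rewrite invsqrt_iter_horner hornerC horner_exp.
  rewrite /Q (invsqrt_iter_morph (real_complex R)); congr (invsqrt_iter _ _ _).
  have xr := Kr _ Kx0; have zr := Kr _ Kz.
  pose r := complex.Re z - complex.Re x0.
  have zx : z - x0 = (r%:C)%C.
    rewrite /r; move: xr zr; case: (x0) (z) => [a c] [a' c'] /= -> ->.
    by apply/eqP; rewrite eq_complex /= subrr !eqxx.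
  have rE : cmod (x0 - z) ^+ 2 = r ^+ 2.
    by rewrite cmodB zx /ComplexField.Normc.normc/= expr0n/= addr0 sqrtr_sqr real_normK// num_real.
  have -> : Y.[z] = ((b^-1 * r)%:C)%C.
    by rewrite /Y hornerM hornerC hornerXsubC zx -rmorphM.
  by rewrite /t [in RHS]exprMn rE -exprMn [r / b]mulrC rmorphXn.
have Q1 z : K z -> 1 <= Q m z.
  by move=> Kz; have /andP[h1 h2] := t01 _ Kz; have [] := invsqrt_iter_bounds m h1 h2.
pose p := qm ^+ n.
have pE z : K z -> p.[z] = ((Q m z ^+ n)%:C)%C.
  by move=> Kz; rewrite /p horner_exp qE// rmorphXn.
have ppos : positive_poly_on K p.
  move=> z Kz; rewrite pE// ltcR exprn_gt0//; exact: lt_le_trans (Q1 _ Kz).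
have pw z : K z -> poly_weight p z = Q m z ^+ n by move=> Kz; rewrite /poly_weight pE.
exists p => //; have hw := positive_poly_szego cK rhoE ppos.
have [Tn Tmin] := weighted_chebyshevP cK capK rhoE hw n0.
have Pn : monic_of_degree n (('X - x0%:P) ^+ n).
  by split; [rewrite monic_exp// monicXsubC|rewrite size_exp_XsubC].
(* The test polynomial is [('X - x0%:P) ^+ n]: on [K], [Q m z * cmod (x0 - z) = b * (t z * Q m z) <=
   b]. *)
have Wb : wnorm K (poly_weight p) (weighted_chebyshev K (poly_weight p) n) <= b ^+ n.
  apply: le_trans (Tmin _ Pn) _; apply: (wnorm_le cK rhoE hw) => z Kz.
  have /andP[h1 h2] := t01 _ Kz; have [q1 tq1 _] := invsqrt_iter_bounds m h1 h2.
  rewrite pw// horner_exp !hornerE cmodX cmodB -exprMn.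
  have -> : Q m z * cmod (x0 - z) = b * (t z * Q m z).
    by rewrite /t; field; rewrite gt_eqF.
  have tq0 : 0 <= t z * Q m z by rewrite mulr_ge0// (le_trans ler01).
  have btq : b * (t z * Q m z) <= b by rewrite ger_pMr.
  by apply: (lerXn2r n) => //; rewrite nnegrE ?(ltW b0)//; exact: mulr_ge0 (ltW b0) tq0.
have [v [vi vE SE]] := szego_integral_log cK rhoE hw.
(* The logarithm of the weight is [n] times [U m z - ln (t z)], and [ln t] integrates to
   [ln (cap K) - ln b] by the choice of [x0]. *)
have Iv : \int[rho]_z v z = n%:R * (\int[rho]_z U m z - (ln (cap K) - ln b)).
  have i0 := ln_dist_integrable cK capK rhoE x0.
  have i1 := integrableB measurableT i0 (integrable_cst rho (ln b)).
  have i2 := integrableB measurableT (Ui m) i1.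
  have -> : ln (cap K) - ln b = \int[rho]_z (ln (cmod (x0 - z)) - ln b).
    rewrite RintegralB//; last exact: integrable_cst.
    by rewrite prob_Rintegral_cst -/(log_potential rho x0) x0c.
  rewrite -(RintegralB measurableT (Ui m) i1) -(RintegralZl n%:R measurableT i2).
  rewrite /Rintegral; congr fine; apply: ae_eq_integral => //.
  - exact: measurable_int vi.
  - exact: measurable_int (integrableZl measurableT n%:R i2).
  have vt : {ae rho, forall z, v z = ln (poly_weight p z) /\ (K z /\ 0 < t z)}.
    by apply: filterS2 vE tpos => z; split.
  apply: filterS2 vt lnt => z [vz [Kz tz]] tE _; congr EFin.
  rewrite vz pw// lnXn; last exact: lt_le_trans (Q1 _ Kz).
  rewrite /U lnM ?posrE//; last exact: lt_le_trans (Q1 _ Kz).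
  rewrite tE -[LHS]mulr_natl; congr (_ * _).
  by rewrite /cst [RHS]addrAC subrr add0r.
rewrite ler_pdivrMr; last by rewrite SE expR_gt0.
rewrite /widom_factor ler_pdivrMr ?exprn_gt0// SE Iv.
apply: (le_trans Wb); apply: sharp_bound b0 capK e0 _.
rewrite -mulrN mulrC -ler_pdivlMr//.
by apply: le_trans (ltW mlt); rewrite -normrN ler_norm.
Qed.

Lemma polynomial_weight_inf n : K `<=` [set z | complex.Im z = 0] -> (0 < n)%N ->
  inf [set widom_factor K (poly_weight p) n / szego_integral K rho (poly_weight p)
      | p in positive_poly_on K] = 1.
Proof.
move=> Kr n0; set A := [set _ | _ in _].
have lbA : lbound A 1.
  move=> _ [p ppos <-]; have hw := positive_poly_szego cK rhoE ppos.
  rewrite ler_pdivlMr ?(szego_integral_gt0 cK rhoE hw)// mul1r.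
  exact: (szego_integral_le_widom cK capK rhoE hw).
have A0 : A !=set0.
  have [p ppos _] := polynomial_weight_sharp Kr n0 ltr01.
  by eexists; exists p.
apply/eqP; rewrite eq_le lb_le_inf// andbT; apply/ler_addgt0Pr => e e0.
have [p ppos pe] := polynomial_weight_sharp Kr n0 e0.
apply: le_trans pe; apply: ge_inf; first by exists 1.
by exists p.
Qed.

End Sharpness.

Theorem theorem13 (R : realType) (K : set R[i]) (rho : probability R[i] R)
    (K_compact : compact K) (cap_gt0 : 0 < cap K)
    (rhoE : is_equilibrium_measure K rho) :
  (forall w : R[i] -> R, szego_class K rho w ->
    [/\ forall n : nat, (0 < n)%N ->
          szego_integral K rho w <= widom_factor K w n,
        forall n : nat, (0 < n)%N ->
          let extremal (P : {poly R[i]}) :=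
            [/\ monic_of_degree n P,
                forall z, root P z -> green K rho z = 0%E &
                {ae rho, forall z, K z ->
                   w z * cmod P.[z] = wnorm K w P}] in
          (widom_factor K w n = szego_integral K rho w <->
             exists P, extremal P) /\
          (forall P, extremal P -> P = weighted_chebyshev K w n) &
        K `<=` [set z | complex.Im z = 0] \/
          (polynomial_hull K)° = set0 ->
        forall n : nat, (0 < n)%N ->
          szego_integral K rho w < widom_factor K w n])
  /\
  (K `<=` [set z | complex.Im z = 0] ->
   forall n : nat, (0 < n)%N ->
     inf [set widom_factor K (poly_weight p) n
                / szego_integral K rho (poly_weight p)
         | p in positive_poly_on K] = 1).
Proof.
split=> [w hw|Kr n n0]; last exact: (polynomial_weight_inf K_compact cap_gt0 rhoE Kr n0).
have chebP n (n0 : (0 < n)%N) := weighted_chebyshevP K_compact cap_gt0 rhoE hw n0.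
split=> [n n0|n n0 extremal|geo n n0].
- exact: (szego_integral_le_widom K_compact cap_gt0 rhoE hw n0).
- have [Tn Tmin] := chebP n n0.
  have extP P : extremal P ->
      wnorm K w P = szego_integral K rho w * cap K ^+ n.
    by move=> [Pn Pg Pae]; apply/(wnorm_eqP K_compact cap_gt0 rhoE hw Pn).
  (* The minimal norm lies between the lower bound and the norm of [P], which coincide. *)
  have extT P : extremal P -> wnorm K w (weighted_chebyshev K w n) =
      szego_integral K rho w * cap K ^+ n.
    move=> Pext; have [Pn _ _] := Pext.
    apply/eqP; rewrite eq_le -{1}(extP _ Pext) (Tmin _ Pn)/=.
    exact: (wnorm_ge K_compact cap_gt0 rhoE hw Tn).
  split; last first.
    move=> P Pext; have [Pn _ _] := Pext.
    exact: (wnorm_eq_unique K_compact cap_gt0 rhoE hw Pn Tn (extP _ Pext) (extT _ Pext)).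
  split=> [/(widom_eqP rho cap_gt0 w n0) TN|[P /extT]]; last by move/(widom_eqP rho cap_gt0 w n0).
  exists (weighted_chebyshev K w n).
  by have [Tg Tae] := (wnorm_eqP K_compact cap_gt0 rhoE hw Tn).1 TN; split.
- have [Tn _] := chebP n n0.
  rewrite /widom_factor ltr_pdivlMr ?exprn_gt0//.
  exact: (wnorm_strict K_compact cap_gt0 rhoE hw n0 Tn geo).
Qed.
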